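(* Let $\mathbb{K}\in\{\mathbb{R},\mathbb{C}\}$ and let $\mathcal{X}$ be a topological $\mathbb{K}$-vector space whose topological dual $\mathcal{X}^{\ast}$ separates the points of $\mathcal{X}$. (i) If $\mathcal{X}$ is a separable Gateaux-differentiability space and $\mathcal{U}$ is a $0$-neighborhood in $\mathcal{X}$ satisfying the infinite-dimensionality condition, then $\mathcal{D}_{\mathcal{U}}$ is a dense $G_\delta$ subset of $\mathbf{CU}_{\mathcal{U}}(\mathcal{X}^{\ast})$ in the weak*-Hausdorff hypertopology. (ii) If $\mathcal{X}$ is separable and completely metrizable and some $0$-neighborhood in $\mathcal{X}$ satisfies the infinite-dimensionality condition, then $\mathcal{D}$ is a dense $G_\delta$ subset of $\mathbf{CU}(\mathcal{X}^{\ast})$ in the weak*-Hausdorff hypertopology.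
   Context: Topological vector spaces are Hausdorff; $\mathcal{X}^{\ast}$ carries the weak* topology. $\mathcal{X}$ is a Gateaux-differentiability space if every continuous convex real-valued function whose domain is a nonempty open convex subset of $\mathcal{X}$ is Gateaux-differentiable on a dense subset of that domain. A $0$-neighborhood $\mathcal{U}$ satisfies the infinite-dimensionality condition if there is an infinite set $\{\sigma_n\}_{n\in\mathbb{N}}$ of linearly independent elements of $\mathcal{X}^{\ast}$ with $\sup_{A\in\mathcal{U}}|\sigma_n(A)|<\infty$ for every $n$. $\mathcal{U}^{\circ}=\{\sigma\in\mathcal{X}^{\ast}:|\sigma(A)|\le1\ \forall A\in\mathcal{U}\}$; $\mathbf{CU}_{\mathcal{U}}(\mathcal{X}^{\ast})$ is the set of nonempty convex weak*-closed subsets of $\mathcal{U}^{\circ}$ and $\mathbf{CU}(\mathcal{X}^{\ast})=\bigcup_{\mathcal{U}}\mathbf{CU}_{\mathcal{U}}(\mathcal{X}^{\ast})$ over all $0$-neighborhoods. $\mathcal{D}_{\mathcal{U}}=\{U\in\mathbf{CU}_{\mathcal{U}}(\mathcal{X}^{\ast}):U=\overline{\mathcal{E}(U)}\}$ with $\mathcal{E}(U)$ the extreme points and weak*-closure, and $\mathcal{D}=\bigcup_{\mathcal{U}}\mathcal{D}_{\mathcal{U}}$. The weak*-Hausdorff hypertopology is generated by the extended pseudometrics $d_H^{(A)}(F,\tilde F)=\max\{\sup_{\sigma\in F}\inf_{\tilde\sigma\in\tilde F}|(\sigma-\tilde\sigma)(A)|,\ \sup_{\tilde\sigma\in\tilde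 F}\inf_{\sigma\in F}|(\sigma-\tilde\sigma)(A)|\}$, $A\in\mathcal{X}$. *)

(* Defs.v *)
From HB Require Import structures.
From mathcomp Require Import all_boot all_order all_algebra.
From mathcomp Require Import all_classical all_reals all_analysis.
From mathcomp.real_closed Require Export complex.
Import Order.TTheory GRing.Theory Num.Theory.
Import numFieldTopology.Exports.
Import numFieldNormedType.Exports.
Set Implicit Arguments. Unset Strict Implicit. Unset Printing Implicit Defensive.
Local Open Scope classical_set_scope.
Local Open Scope ring_scope.

(* Throughout: R is the real field, K the scalar field (R or R[i]),
   emb : R -> K the embedding of the reals into K, nK : K -> R the
   (real-valued) absolute value of K.  X is a topological K-vector space;
   functionals X -> K are the candidates for elements of the dual X^star. *)

Definition dual {K : numFieldType} {X : topologicalLmodType K} (s : X -> K) : Prop :=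
  (forall (a : K) (x y : X), s (a *: x + y) = a * s x + s y) /\ continuous s.

Definition dual_separates (K : numFieldType) (X : topologicalLmodType K) : Prop :=
  forall x y : X, x <> y -> exists s : X -> K, dual s /\ s x <> s y.

Definition wclosure {R : realType} {K : numFieldType} {X : topologicalLmodType K}
  (nK : K -> R) (F : set (X -> K)) : set (X -> K) :=
  [set s | dual s /\ forall (S : seq X) (e : R), 0 < e ->
      exists2 t, F t & forall A, A \in S -> nK (s A - t A) < e].

Definition wclosed {R : realType} {K : numFieldType} {X : topologicalLmodType K}
  (nK : K -> R) (F : set (X -> K)) : Prop := wclosure nK F `<=` F.

Definition convex_fset {R : realType} {K : numFieldType} {X : topologicalLmodType K}
  (emb : R -> K) (F : set (X -> K)) : Prop :=
  forall s t, F s -> F t -> forall r : R, 0 <= r <= 1 ->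
    F (fun A => emb r * s A + (1 - emb r) * t A).

Definition polar {R : realType} {K : numFieldType} {X : topologicalLmodType K}
  (nK : K -> R) (U : set X) : set (X -> K) :=
  [set s | dual s /\ forall A, U A -> nK (s A) <= 1].

Definition CU_U {R : realType} {K : numFieldType} {X : topologicalLmodType K}
  (emb : R -> K) (nK : K -> R) (U : set X) : set (set (X -> K)) :=
  [set F | F !=set0 /\ convex_fset emb F /\ wclosed nK F /\ F `<=` polar nK U].

Definition CU {R : realType} {K : numFieldType} {X : topologicalLmodType K}
  (emb : R -> K) (nK : K -> R) : set (set (X -> K)) :=
  [set F | exists U : set X, nbhs (0 : X) U /\ CU_U emb nK U F].

Definition extreme {R : realType} {K : numFieldType} {X : topologicalLmodType K}
  (emb : R -> K) (F : set (X -> K)) : set (X -> K) :=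
  [set s | F s /\ forall (t1 t2 : X -> K) (r : R), F t1 -> F t2 -> 0 < r < 1 ->
     s = (fun A => emb r * t1 A + (1 - emb r) * t2 A) -> t1 = t2].

Definition D_U {R : realType} {K : numFieldType} {X : topologicalLmodType K}
  (emb : R -> K) (nK : K -> R) (U : set X) : set (set (X -> K)) :=
  [set F | CU_U emb nK U F /\ F = wclosure nK (extreme emb F)].

Definition D_all {R : realType} {K : numFieldType} {X : topologicalLmodType K}
  (emb : R -> K) (nK : K -> R) : set (set (X -> K)) :=
  [set F | exists U : set X, nbhs (0 : X) U /\ D_U emb nK U F].

Definition hdist {R : realType} {K : numFieldType} {X : topologicalLmodType K}
  (nK : K -> R) (A : X) (F G : set (X -> K)) : \bar R :=
  maxe (ereal_sup [set ereal_inf [set (nK (s A - t A))%:E | t in G] | s in F])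
       (ereal_sup [set ereal_inf [set (nK (s A - t A))%:E | s in F] | t in G]).

(** open sets of the weak*-Hausdorff hypertopology (topology generated by the
    family of extended pseudometrics hdist A, A in X), relative to C. *)
Definition hopen {R : realType} {K : numFieldType} {X : topologicalLmodType K}
  (nK : K -> R) (C O : set (set (X -> K))) : Prop :=
  O `<=` C /\ forall F, O F -> exists (S : seq X) (e : R), 0 < e /\
     [set G | C G /\ forall A, A \in S -> (hdist nK A F G < e%:E)%E] `<=` O.

Definition hdense {R : realType} {K : numFieldType} {X : topologicalLmodType K}
  (nK : K -> R) (C Dset : set (set (X -> K))) : Prop :=
  Dset `<=` C /\ forall O, hopen nK C O -> O !=set0 -> exists F, O F /\ Dset F.

Definition hGdelta {R : realType} {K : numFieldType} {X : topologicalLmodType K}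
  (nK : K -> R) (C Dset : set (set (X -> K))) : Prop :=
  exists O : nat -> set (set (X -> K)),
    (forall n, hopen nK C (O n)) /\ Dset = \bigcap_n O n.

Definition infdim_cond {R : realType} {K : numFieldType} {X : topologicalLmodType K}
  (nK : K -> R) (U : set X) : Prop :=
  exists sg : nat -> (X -> K),
    (forall n, dual (sg n)) /\
    (forall (N : nat) (c : nat -> K),
        (forall A, \sum_(i < N) c i * sg i A = 0) -> forall i, (i < N)%N -> c i = 0) /\
    (forall n, exists M : R, forall A, U A -> nK (sg n A) <= M).

Definition separable_space (T : topologicalType) : Prop :=
  exists S : set T, countable S /\ closure S = setT.

Definition completely_metrizable (R : realType) (T : topologicalType) : Prop :=
  exists d : T -> T -> R,
    (forall x y, 0 <= d x y) /\ (forall x y, d x y = 0 <-> x = y) /\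
    (forall x y, d x y = d y x) /\ (forall x y z, d x z <= d x y + d y z) /\
    (forall (x : T) (V : set T), nbhs x V <-> exists2 e : R, 0 < e & [set y | d x y < e] `<=` V) /\
    (forall u : nat -> T,
       (forall e : R, 0 < e -> exists N, forall m n, (N <= m)%N -> (N <= n)%N -> d (u m) (u n) < e) ->
       exists l, forall e : R, 0 < e -> exists N, forall n, (N <= n)%N -> d l (u n) < e).

Definition gateaux_diff {R : realType} {K : numFieldType} {X : topologicalLmodType K}
  (emb : R -> K) (f : X -> R) (x : X) : Prop :=
  exists L : X -> R,
    (forall y z, L (y + z) = L y + L z) /\ (forall (r : R) y, L (emb r *: y) = r * L y) /\
    continuous L /\
    forall h : X, (fun t : R => (f (x + emb t *: h) - f x) / t) @ 0^' --> L h.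

Definition convex_Xset {R : realType} {K : numFieldType} {X : topologicalLmodType K}
  (emb : R -> K) (D : set X) : Prop :=
  forall x y (r : R), D x -> D y -> 0 <= r <= 1 -> D (emb r *: x + emb (1 - r) *: y).

Definition convex_fun_on {R : realType} {K : numFieldType} {X : topologicalLmodType K}
  (emb : R -> K) (D : set X) (f : X -> R) : Prop :=
  forall x y (r : R), D x -> D y -> 0 <= r <= 1 ->
    f (emb r *: x + emb (1 - r) *: y) <= r * f x + (1 - r) * f y.

Definition gateaux_space {R : realType} {K : numFieldType} (emb : R -> K)
  (X : topologicalLmodType K) : Prop :=
  forall (D : set X) (f : X -> R),
    D !=set0 -> open D -> convex_Xset emb D -> convex_fun_on emb D f ->
    (forall x, D x -> f @ x --> f x) ->
    exists2 G : set X, G `<=` D & (forall x, G x -> gateaux_diff emb f x) /\ D `<=` closure G.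

Definition Thm412 (R : realType) (K : numFieldType) (emb : R -> K) (nK : K -> R) : Prop :=
  forall X : topologicalLmodType K, hausdorff_space X -> dual_separates X ->
  (forall U : set X, separable_space X -> gateaux_space emb X ->
     nbhs (0 : X) U -> infdim_cond nK U ->
     hGdelta nK (CU_U emb nK U) (D_U emb nK U) /\ hdense nK (CU_U emb nK U) (D_U emb nK U)) /\
  (separable_space X -> completely_metrizable R X ->
     (exists U : set X, nbhs (0 : X) U /\ infdim_cond nK U) ->
     hGdelta nK (CU (X := X) emb nK) (D_all emb nK) /\ hdense nK (CU (X := X) emb nK) (D_all emb nK)).

(* Main.v *)
(** Polars are weak*-compact, and in a separable space every functional A attains
    its maximum over a compact convex F at an extreme point, found by maximizing
    A and then successively the members of a dense sequence.  Conversely (Choquet)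
    each extreme point of F has arbitrarily small half-space slices of F as
    neighbourhoods.  Hence the extreme points are dense in F if and only if, for
    every n, F is covered by finitely many 1/n-small neighbourhoods, each containing
    a slice of F.  For fixed n this is an open condition on F: it only involves
    finitely many coordinates, and in a finite-dimensional projection a
    neighbourhood of a compact convex set contains an intersection of finitely many
    half-spaces around it, which single-vector Hausdorff distances control.  This
    gives the G_delta property.

    For density, F is approximated by a Poulsen-type set: the weak*-closure G of a
    sequence (v_n) that starts with a slightly perturbed finite net of (1 - eps) F
    and continues with perturbed midpoints (v_i + v_j) / 2 + delta_n tau_n, every
    pair (i, j) occurring infinitely often, so that G is convex.  The directions
    tau_n keep the v_n linearly independent, which provides vectors A_n with
    v_n(A_n) = 1 and v_i(A_n) = 0 for i < n; if delta_n decreases fast enough, the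
    face of G where A_n is maximal lies within O(2^-n) of v_n, and it contains an
    extreme point. *)
Require Import Defs.
From HB Require Import structures.
From mathcomp Require Import all_boot all_order all_algebra.
From mathcomp Require Import all_classical all_reals all_analysis.
From mathcomp.real_closed Require Import complex.
From mathcomp Require Import zify ring lra.
Import Order.TTheory GRing.Theory Num.Theory.
Import numFieldTopology.Exports.
Import numFieldNormedType.Exports.
Set Implicit Arguments. Unset Strict Implicit. Unset Printing Implicit Defensive.
Local Open Scope classical_set_scope.
Local Open Scope ring_scope.

(* Treats K = R and K = C uniformly: re is the real part, and re_dec recovers x
   from the real parts of x and jj * x (jj = kk = 0 over R; jj = i, kk = -i over C). *)
Record real_part (R : realType) (K : numFieldType) (emb : {rmorphism R -> K})
    (nK : K -> R) (re : K -> R) (jj kk : K) : Prop := {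
  emb_le : forall a b, (emb a <= emb b) = (a <= b);
  emb_nK : forall x, emb (nK x) = `|x|;
  reD : forall x y, re (x + y) = re x + re y;
  reZ : forall r x, re (emb r * x) = r * re x;
  re1 : re 1 = 1;
  re_le_nK : forall x, `|re x| <= nK x;
  re_dec : forall x, x = emb (re x) + emb (re (jj * x)) * kk;
  nK_kk : nK kk <= 1
}.

Lemma real_part_real (R : realType) :
  @real_part R R idfun Num.norm id 0 0.
Proof.
split => //= [x|]; first by rewrite mulr0 addr0.
by rewrite normr0.
Qed.

Lemma real_part_complex (R : realType) :
  @real_part R R[i] (real_complex R) (@ComplexField.Normc.normc R)
    (@complex.Re R) 'i%C (- 'i%C).
Proof.
split.
- by move=> a b; rewrite lecR.
- by [].
- by case=> a b [c d].
- by move=> r [a b] /=; rewrite mul0r subr0.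
- by [].
- move=> [a b] /=; rewrite -sqrtr_sqr ler_sqrt ?lerDl ?sqr_ge0 //.
  by rewrite addr_ge0 ?sqr_ge0.
- by move=> [a b]; apply/eqP; rewrite eq_complex /=; apply/andP; split;
    apply/eqP; ring.
- by rewrite /= oppr0 sqrrN expr0n /= expr1n add0r sqrtr1.
Qed.

(** * Scalars: norm, real part, topology and compact balls *)

Section Scalars.
Variables (R : realType) (K : numFieldType) (emb : {rmorphism R -> K}).
Variables (nK re : K -> R) (jj kk : K) (H : real_part emb nK re jj kk).

Lemma emb_inj : injective emb.
Proof. by move=> a b e; apply/eqP; rewrite eq_le -!(emb_le H) e lexx. Qed.

Lemma re0 : re 0 = 0.
Proof. by have := reZ H 0 0; rewrite mulr0 mul0r. Qed.

Lemma reN x : re (- x) = - re x.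
Proof. by have := reD H x (- x); rewrite subrr re0; lra. Qed.

Lemma reB x y : re (x - y) = re x - re y.
Proof. by rewrite (reD H) reN. Qed.

Lemma re_sum (I : Type) (r : seq I) (F : I -> K) :
  re (\sum_(i <- r) F i) = \sum_(i <- r) re (F i).
Proof. exact: (big_morph re (reD H) re0). Qed.

Lemma nK_ge0 x : 0 <= nK x.
Proof. by rewrite -(emb_le H) rmorph0 (emb_nK H). Qed.

Lemma nKD x y : nK (x + y) <= nK x + nK y.
Proof. by rewrite -(emb_le H) rmorphD /= !(emb_nK H) ler_normD. Qed.

Lemma nKM x y : nK (x * y) = nK x * nK y.
Proof. by apply: emb_inj; rewrite rmorphM /= !(emb_nK H) normrM. Qed.

Lemma nK0 : nK 0 = 0.
Proof. by apply: emb_inj; rewrite (emb_nK H) normr0 rmorph0. Qed.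

Lemma nKN x : nK (- x) = nK x.
Proof. by apply: emb_inj; rewrite !(emb_nK H) normrN. Qed.

Lemma nK_distC x y : nK (x - y) = nK (y - x).
Proof. by rewrite -nKN opprB. Qed.

Lemma nK_emb r : 0 <= r -> nK (emb r) = r.
Proof.
by move=> r0; apply: emb_inj; rewrite (emb_nK H) ger0_norm// -(rmorph0 emb) (emb_le H).
Qed.

Lemma nK_eq0 x : nK x = 0 -> x = 0.
Proof. by move=> x0; apply/eqP; rewrite -normr_eq0 -(emb_nK H) x0 rmorph0. Qed.

Lemma nK_emb_norm r : nK (emb r) = `|r|.
Proof.
have [r0|r0] := leP 0 r; first by rewrite nK_emb// ger0_norm.
by rewrite -[r in emb r]opprK rmorphN nKN nK_emb ?ltr0_norm// oppr_ge0 ltW.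
Qed.

Lemma nK_le_re x : nK x <= `|re x| + `|re (jj * x)|.
Proof.
rewrite {1}(re_dec H x); apply: (le_trans (nKD _ _)).
rewrite nKM !nK_emb_norm lerD2l ler_piMr //; exact: (nK_kk H).
Qed.

(** Balls of [K] have their radii in [K]; a positive radius equals its own norm, so it is the image
    under [emb] of a real one. *)
Lemma nbhsKP (x : K) (A : set K) :
  nbhs x A <-> exists2 e : R, 0 < e & [set y | nK (y - x) < e] `<=` A.
Proof.
have ltE (a b : R) : (emb a < emb b) = (a < b).
  by rewrite !lt_def (emb_le H) (inj_eq emb_inj).
split.
- move=> /nbhs_ballP [/= e e0 eA].
  have ee : e = emb (nK e) by rewrite (emb_nK H) gtr0_norm.
  exists (nK e); first by rewrite -ltE -ee rmorph0.
  move=> y /= ye; apply: eA; rewrite /ball/=.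
  by rewrite distrC -(emb_nK H) ee ltE.
- move=> [e e0 eA]; apply/nbhs_ballP; exists (emb e) => /=.
    by rewrite -(rmorph0 emb) ltE.
  move=> y; rewrite /ball/= => ye; apply: eA => /=.
  by rewrite -ltE (emb_nK H) distrC.
Qed.

Lemma nbhsK_ball (x : K) (e : R) : 0 < e -> nbhs x [set y | nK (y - x) < e].
Proof. by move=> e0; apply/nbhsKP; exists e. Qed.

Lemma re_continuous : continuous re.
Proof.
move=> x A /nbhs_ballP [e e0 eA]; apply/nbhsKP; exists e => // y /= xy.
apply: eA; rewrite /ball /=; move: xy.
by apply: le_lt_trans; rewrite distrC -reB (re_le_nK H).
Qed.

Lemma nK_dist_continuous (c : K) : continuous (fun x => nK (x - c)).
Proof.
move=> x A /nbhs_ballP [e e0 eA]; apply/nbhsKP; exists e => // y /= xy.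
apply: eA; rewrite /ball /=; move: xy.
have := nKD (y - x) (x - c); have := nKD (x - y) (y - c).
by rewrite !subrKA (nK_distC x y) ltr_distl; lra.
Qed.

Lemma emb_continuous : continuous emb.
Proof.
move=> x A /nbhsKP [e e0 eA].
apply/nbhs_ballP; exists e => // y; rewrite /ball/= => xy; apply: eA => /=.
rewrite -rmorphB; apply: (le_lt_trans _ xy).
have [h|h] := leP 0 (y - x); first by rewrite nK_emb// distrC ger0_norm.
by rewrite -nKN -rmorphN opprB nK_emb ?ler_norm// -opprB oppr_ge0 ltW.
Qed.

Lemma comb_continuous :
  continuous (fun p : R * (K * K) => emb p.1 * p.2.1 + (1 - emb p.1) * p.2.2).
Proof.
move=> p; have cemb : (emb x.1) @[x --> p] --> emb p.1.
  by apply: continuous_comp; [exact: cvg_fst|exact: emb_continuous].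
have cl : x.2.1 @[x --> p] --> p.2.1.
  by apply: continuous_comp; [exact: cvg_snd|exact: cvg_fst].
have cr : x.2.2 @[x --> p] --> p.2.2.
  by apply: continuous_comp; [exact: cvg_snd|exact: cvg_snd].
apply: cvgD; first exact: cvgM.
by apply: cvgM => //; apply: cvgB => //; exact: cvg_cst.
Qed.

Lemma compact_nK_ball (M : R) : compact [set x : K | nK x <= M].
Proof.
pose f (p : R * R) : K := emb p.1 + emb p.2 * kk.
have cf : continuous f.
  move=> p; apply: cvgD.
    by apply: continuous_comp; [exact: cvg_fst|exact: emb_continuous].
  apply: cvgM; last exact: cvg_cst.
  by apply: continuous_comp; [exact: cvg_snd|exact: emb_continuous].
pose M' := nK jj * M + M.
apply: (@subclosed_compact _ _ (f @` (`[- M, M]%classic `*` `[- M', M']%classic))).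
- rewrite (_ : [set x | _] = (fun x => nK (x - 0)) @^-1` [set y | y <= M]).
    by apply: (preimage_closed _ (@closed_le _ M)) => x _; exact: nK_dist_continuous.
  by apply/seteqP; split => x /=; rewrite subr0.
- apply: continuous_compact; first exact: continuous_subspaceT.
  by apply: compact_setX; exact: segment_compact.
- move=> x /= xM; exists (re x, re (jj * x)) => /=; last by rewrite /f /= -(re_dec H).
  have M0 : 0 <= M by apply: le_trans xM; exact: nK_ge0.
  split => /=; rewrite in_itv /= -ler_norml.
    exact: (le_trans (re_le_nK H _)).
  apply: (le_trans (re_le_nK H _)); rewrite nKM /M'.
  by rewrite (le_trans (ler_wpM2l (nK_ge0 _) xM))// lerDl.
Qed.

End Scalars.

(** * Linear functionals, polars and their equicontinuity *)

Section Dual.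
Variables (R : realType) (K : numFieldType) (emb : {rmorphism R -> K}).
Variables (nK re : K -> R) (jj kk : K) (H : real_part emb nK re jj kk).
Variable X : topologicalLmodType K.
Implicit Types (s t : X -> K) (U : set X) (A B : X).

Definition klinear s := forall (a : K) (x y : X), s (a *: x + y) = a * s x + s y.

Section Linear.
Variables (s : X -> K) (ls : klinear s).

Lemma klin0 : s 0 = 0.
Proof.
have := ls 1 0 0; rewrite scale1r addr0 mul1r => /eqP.
by rewrite -subr_eq subrr eq_sym => /eqP.
Qed.

Lemma klinZ a x : s (a *: x) = a * s x.
Proof. by have := ls a x 0; rewrite klin0 !addr0. Qed.

Lemma klinD x y : s (x + y) = s x + s y.
Proof. by have := ls 1 x y; rewrite scale1r mul1r. Qed.

Lemma klinN x : s (- x) = - s x.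
Proof. by rewrite -scaleN1r klinZ mulN1r. Qed.

Lemma klinB x y : s (x - y) = s x - s y.
Proof. by rewrite klinD klinN. Qed.

Lemma klin_sum (I : Type) (r : seq I) (F : I -> X) :
  s (\sum_(i <- r) F i) = \sum_(i <- r) s (F i).
Proof. exact: (big_morph s klinD klin0). Qed.

End Linear.

Lemma klinear_comb (a b : K) s t : klinear s -> klinear t ->
  klinear (fun A => a * s A + b * t A).
Proof. by move=> ls lt c x y; rewrite ls lt; ring. Qed.

Lemma polar_klinear U s : polar nK U s -> klinear s.
Proof. by case=> -[]. Qed.

Lemma nbhs_scaled U x (c : K) : nbhs (0 : X) U -> nbhs x [set y | U (c *: (y - x))].
Proof.
move=> U0; have cf : {for x, continuous (fun y : X => c *: (y - x))}.
  have /= h := @scale_continuous K X (c, x - x).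
  apply: (@continuous_comp _ (K^o * X)%type _ (fun y => (c, y - x))
    (fun z : K^o * X => z.1 *: z.2)); last exact: h.
  apply: (@cvg_pair _ _ _ _ (nbhs (c : K^o))); first exact: cvg_cst.
  apply: (@continuous_comp _ (X * X)%type _ (fun y => (y, x))
    (fun z : X * X => z.1 - z.2)); last exact: sub_continuous.
  by apply: cvg_pair; [exact: cvg_id|exact: cvg_cst].
by apply: cf => /=; rewrite subrr scaler0.
Qed.

Lemma nbhs0_absorbs U A : nbhs (0 : X) U -> exists2 r : R, 0 < r & U (emb r *: A).
Proof.
move=> U0; have cf : {for (0 : R), continuous (fun r : R => emb r *: A)}.
  have /= h := @scale_continuous K X (emb 0, A).
  apply: (@continuous_comp _ (K^o * X)%type _ (fun r => (emb r, A))
    (fun z : K^o * X => z.1 *: z.2)); last exact: h.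
  apply: (@cvg_pair _ _ _ _ (nbhs (emb 0 : K^o))); last exact: cvg_cst.
  exact: (emb_continuous H).
have /cf : nbhs (emb 0 *: A) U by rewrite rmorph0 scale0r.
move=> /nbhs_ballP [e /= e0 eU]; exists (e / 2); first by rewrite divr_gt0.
by apply: eU; rewrite /ball /= sub0r normrN ger0_norm; lra.
Qed.

(** If [(2 / e) (y - x)] lies in [U], then [s] varies by at most [e / 2] between [x] and [y], which
    gives continuity. *)
Lemma klinear_polar U s : nbhs (0 : X) U -> klinear s ->
  (forall A, U A -> nK (s A) <= 1) -> polar nK U s.
Proof.
move=> U0 ls sU; split=> //; split=> // x V /(nbhsKP H) [e e0 eV].
apply: (@filterS _ (nbhs x) _ _ _ _ (nbhs_scaled x (emb (2 / e)) U0)) => y /= Uy.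
have ce : 0 <= 2 / e by rewrite divr_ge0 // ltW.
apply: eV => /=; rewrite -(klinB ls); move: (sU _ Uy).
rewrite (klinZ ls) (nKM H) (nK_emb H ce) mulrAC ler_pdivrMr // mul1r.
by have := nK_ge0 H (s (y - x)); lra.
Qed.

(** [U] absorbs [A]: some [emb r *: A] with [r > 0] lies in [U], and [1 / r] bounds the whole polar
    at [A]. This bound yields compactness of polars and later error estimates. *)
Lemma gaugeP U : nbhs (0 : X) U -> exists g : X -> R,
  (forall A, 0 <= g A) /\ forall s A, polar nK U s -> nK (s A) <= g A.
Proof.
move=> U0; pose r A := sval (cid2 (nbhs0_absorbs A U0)).
have rP A : 0 < r A /\ U (emb (r A) *: A) by rewrite /r; case: cid2.
exists (fun A => (r A)^-1); split=> [A|s A sU].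
  by rewrite invr_ge0 ltW //; case: (rP A).
have [r0 /sU.2] := rP A; rewrite (klinZ (polar_klinear sU)) (nKM H).
by rewrite (nK_emb H (ltW r0)) -ler_pdivlMl// mulr1.
Qed.

Lemma inv_succ_lt (e : R) : 0 < e -> exists n : nat, n.+1%:R^-1 < e.
Proof.
move=> e0; exists (Num.bound e^-1).
have h : e^-1 < (Num.bound e^-1)%:R by apply: archi_boundP; rewrite invr_ge0 ltW.
rewrite invf_plt ?posrE// -natr1; lra.
Qed.

(** Equicontinuity: if [(4 / e) (B i - A)] lies in [U], every functional of the polar differs by at
    most [e / 4] between [A] and [B i]. *)
Lemma polar_dense_re U (B : nat -> X) (S : seq X) (e : R) :
  nbhs (0 : X) U -> closure (range B) = setT -> 0 < e ->
  exists n, forall s t, polar nK U s -> polar nK U t ->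
    (forall i, (i <= n)%N -> `|re (s (B i) - t (B i))| < n.+1%:R^-1) ->
    forall A, A \in S -> `|re (s A - t A)| < e.
Proof.
move=> U0 dB e0; elim: S => [|A S [n hn]]; first by exists 0%N.
have [_ [/= [i _ <-] Ui]] : range B `&` [set y | U (emb (4 / e) *: (y - A))] !=set0.
  have : closure (range B) A by rewrite dB.
  by apply; exact: nbhs_scaled.
have [k hk] : exists k : nat, k.+1%:R^-1 < e / 4 by apply: inv_succ_lt; rewrite divr_gt0.
exists (maxn n (maxn i k)) => s t sU tU hst.
have le_inv m : (m <= maxn n (maxn i k))%N ->
    (maxn n (maxn i k)).+1%:R^-1 <= m.+1%:R^-1 :> R.
  by move=> ?; rewrite lef_pV2 ?posrE ?ltr0n// ler_nat.
move=> A'; rewrite inE => /orP [/eqP ->|]; last first.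
  apply: hn => // j jn; apply: lt_le_trans (le_inv _ (leq_maxl _ _)).
  by apply: hst; rewrite (leq_trans jn)// leq_maxl.
have small w : polar nK U w -> nK (w (B i - A)) <= e / 4.
  move=> wU; have := wU.2 _ Ui; have e40 : 0 <= 4 / e by rewrite divr_ge0 // ltW.
  rewrite (klinZ (polar_klinear wU)) (nKM H) (nK_emb H e40) mulrAC ler_pdivrMr //.
  lra.
have lei : (i <= maxn n (maxn i k))%N by rewrite leq_max leq_maxl orbT.
have lek : (k <= maxn n (maxn i k))%N by rewrite leq_max leq_maxr orbT.
move: (hst i lei) (le_inv _ lek) (le_trans (re_le_nK H _) (small _ sU)) => {hst}.
move: (le_trans (re_le_nK H _) (small _ tU)) hk.
rewrite (klinB (polar_klinear sU)) (klinB (polar_klinear tU)) !(reB H).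
move: (k.+1%:R^-1 : R) ((maxn n _).+1%:R^-1 : R) => p q.
rewrite !ltr_norml !ler_norml => /andP[? ?] ? /andP[? ?] ? /andP[? ?].
by apply/andP; split; lra.
Qed.

(** By [nK_le_re], the norm at [A] is controlled by the real parts at [A] and at [jj *: A]. *)
Lemma polar_dense_approx U (B : nat -> X) (S : seq X) (e : R) :
  nbhs (0 : X) U -> closure (range B) = setT -> 0 < e ->
  exists n, forall s t, polar nK U s -> polar nK U t ->
    (forall i, (i <= n)%N -> `|re (s (B i) - t (B i))| < n.+1%:R^-1) ->
    forall A, A \in S -> nK (s A - t A) < e.
Proof.
move=> U0 dB e0; have e20 : 0 < e / 2 by rewrite divr_gt0.
have [n hn] := polar_dense_re (S ++ [seq jj *: A | A <- S]) U0 dB e20.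
exists n => s t sU tU hst A AS; apply: (le_lt_trans (nK_le_re H _)).
rewrite mulrBr -!(klinZ (polar_klinear sU)) -!(klinZ (polar_klinear tU)).
have h1 := hn s t sU tU hst A; have h2 := hn s t sU tU hst (jj *: A).
by rewrite [e](splitr) ltrD ?h1 ?h2// mem_cat ?AS ?map_f ?orbT.
Qed.

Lemma polar_dense_inj U (B : nat -> X) s t :
  nbhs (0 : X) U -> closure (range B) = setT -> polar nK U s -> polar nK U t ->
  (forall i, re (s (B i)) = re (t (B i))) -> s = t.
Proof.
move=> U0 dB sU tU st; apply/funext => A; apply/eqP; rewrite -subr_eq0.
apply/eqP; apply: (nK_eq0 H); apply/eqP; rewrite eq_le (nK_ge0 H) andbT.
apply/ler_addgt0Pl => e e0; rewrite addr0.
have [n hn] := polar_dense_approx [:: A] U0 dB e0.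
apply/ltW; apply: (hn s t sU tU); last by rewrite mem_head.
by move=> i _; rewrite (reB H) st subrr normr0 invr_gt0 ltr0n.
Qed.

End Dual.

(** * Compactness for pointwise convergence, and extreme points in faces *)

Lemma compact_finite_cover (T : topologicalType) (I : choiceType) (A : set T)
    (P : set I) (U : I -> set T) :
  compact A -> (forall i, P i -> open (U i)) ->
  (forall x, A x -> exists2 i, P i & U i x) ->
  exists L : seq I, (forall i, i \in L -> P i) /\
    forall x, A x -> exists2 i, i \in L & U i x.
Proof.
move=> /compact_near_coveringP cA oU AU.
(* Finite lists of admissible indices, directed by inclusion, give the filter to which near-covering
   compactness is applied. *)
pose Fl : set_system (seq I) := [set B | exists L0 : seq I,
  (forall i, i \in L0 -> P i) /\ forall L : seq I, {subset L0 <= L} -> B L].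
have FlF : Filter Fl.
  split; first by exists [::].
    move=> B C [L1 [P1 B1]] [L2 [P2 C2]]; exists (L1 ++ L2); split.
      by move=> i; rewrite mem_cat => /orP [/P1|/P2].
    move=> L sL; split; [apply: B1|apply: C2] => i iL; apply: sL;
      by rewrite mem_cat iL ?orbT.
  by move=> B C BC [L0 [P0 B0]]; exists L0; split=> // L /B0 /BC.
have [|L [LP AL]] := cA _ Fl (fun L x => exists2 i, i \in L & U i x) FlF.
  move=> x /AU [i Pi Uix]; exists (U i, [set L : seq I | i \in L]) => /=.
    split; first by apply: open_nbhs_nbhs; split => //; exact: oU.
    exists [:: i]; split; first by move=> j; rewrite inE => /eqP ->.
    by move=> L; apply; rewrite mem_head.
  by move=> [y L] [/= Uiy iL]; exists i.
by exists L; split=> // x Ax; exact: AL.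
Qed.

Lemma continuous_sum (T : topologicalType) (R : realType) (I : Type) (r : seq I)
    (F : I -> T -> R) :
  (forall i, continuous (F i)) -> continuous (fun x => \sum_(i <- r) F i x).
Proof.
move=> cF; elim: r => [|i r IH] x.
  rewrite (_ : (fun _ => _) = fun=> 0); first exact: cvg_cst.
  by apply/funext => y; rewrite big_nil.
rewrite (_ : (fun _ => _) = fun y => F i y + \sum_(j <- r) F j y).
  by apply: cvgD; [exact: cF|exact: IH].
by apply/funext => y; rewrite big_cons.
Qed.

Section Compactness.
Variables (R : realType) (K : numFieldType) (emb : {rmorphism R -> K}).
Variables (nK re : K -> R) (jj kk : K) (H : real_part emb nK re jj kk).
Variable X : topologicalLmodType K.
Implicit Types (U : set X) (A B : X) (F : set (X -> K)).

Lemma eval_continuous A : continuous (fun s : {ptws X -> K} => s A).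
Proof. exact: (@proj_continuous X (fun=> K) A). Qed.

Lemma re_eval_continuous A : continuous (fun s : {ptws X -> K} => re (s A)).
Proof.
move=> s; apply: (@continuous_comp _ _ _ (fun s : {ptws X -> K} => s A) re).
  exact: eval_continuous.
exact: (re_continuous H).
Qed.

Lemma nK_eval_continuous A (c : K) :
  continuous (fun s : {ptws X -> K} => nK (s A - c)).
Proof.
move=> s; apply: (@continuous_comp _ _ _ (fun s : {ptws X -> K} => s A)
  (fun x => nK (x - c))); first exact: eval_continuous.
exact: (nK_dist_continuous H).
Qed.

Lemma nbhs_eval (s : {ptws X -> K}) (S : seq X) (e : R) : 0 < e ->
  nbhs s [set t | forall A, A \in S -> nK (t A - s A) < e].
Proof.
move=> e0; elim: S => [|A S IH]; first by apply: (@filterS _ _ (nbhs_filter s) setT) => //;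
  exact: (@filterT _ _ (nbhs_filter s)).
have hA : nbhs s [set t : {ptws X -> K} | nK (t A - s A) < e].
  by apply: (@eval_continuous A s [set y | nK (y - s A) < e]); exact: (nbhsK_ball H).
apply: (@filterS _ _ (nbhs_filter s) _ _ _ (@filterI _ _ (nbhs_filter s) _ _ hA IH)).
  move=> t /= [h1 h2] B.
by rewrite inE => /orP [/eqP ->|/h2].
Qed.

(** Linearity and the bound on [U] involve finitely many values at a time, so they pass to pointwise
    limits; together they restore continuity. *)
Lemma polar_wclosure U F : nbhs (0 : X) U -> F `<=` polar nK U ->
  forall s : {ptws X -> K}, @closure {ptws X -> K} F s -> wclosure nK F s.
Proof.
move=> U0 FU s clF; have ap (S : seq X) (e : R) : 0 < e ->
    exists2 t, F t & forall A, A \in S -> nK (s A - t A) < e.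
  move=> e0; have [t [Ft tS]] := clF _ (nbhs_eval s S e0).
  by exists t => // A AS; rewrite (nK_distC H); exact: tS.
split=> //; suff: polar nK U s by case.
apply: (klinear_polar H U0).
  move=> a x y; apply/eqP; rewrite -subr_eq0; apply/eqP/(nK_eq0 H)/eqP.
  rewrite eq_le (nK_ge0 H) andbT; apply/ler_addgt0Pl => e e0; rewrite addr0.
  (* The three errors in the linearity relation carry the weights 1, [nK a] and 1. *)
  pose d := e / (nK a + 2).
  have a0 := nK_ge0 H a.
  have d0 : 0 < d by rewrite divr_gt0//; lra.
  have [t Ft tS] := ap [:: a *: x + y; x; y] d d0.
  have lt := polar_klinear (FU _ Ft).
  have -> : s (a *: x + y) - (a * s x + s y) = (s (a *: x + y) - t (a *: x + y))
      - (a * (s x - t x) + (s y - t y)).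
    by rewrite lt; ring.
  apply: (le_trans (nKD H _ _)); rewrite (nKN H).
  apply: (le_trans (lerD (lexx _) (nKD H _ _))); rewrite (nKM H).
  have h1 := ltW (tS (a *: x + y) (mem_head _ _)).
  have h2 : nK (s x - t x) <= d by apply/ltW/tS; rewrite !inE eqxx orbT.
  have h3 : nK (s y - t y) <= d by apply/ltW/tS; rewrite !inE eqxx !orbT.
  have -> : e = d + (nK a * d + d) by rewrite /d; field; lra.
  by rewrite lerD// lerD// ler_wpM2l.
move=> A UA; apply/ler_addgt0Pl => e e0.
have [t Ft tS] := ap [:: A] e e0.
have := (FU _ Ft).2 _ UA; have := tS A (mem_head _ _).
by have := nKD H (s A - t A) (t A); rewrite subrK; lra.
Qed.

(** Banach-Alaoglu: [F] is closed in a product of balls of radii [g A], which is compact by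
    Tychonoff. *)
Lemma compact_CU_U U F : nbhs (0 : X) U -> CU_U emb nK U F ->
  compact (F : set {ptws X -> K}).
Proof.
move=> U0 [_ [_ [wF FU]]]; have [g [g0 gU]] := gaugeP H U0.
apply: (@subclosed_compact _ _ [set f : {ptws X -> K} | forall A, nK (f A) <= g A]).
- by move=> s clF; apply: wF; apply: polar_wclosure U0 FU _ clF.
- apply: (@tychonoff X (fun=> K) (fun A => [set x | nK x <= g A])) => A.
  exact: (compact_nK_ball H).
- by move=> s Fs A; apply: gU; exact: FU.
Qed.

Lemma wclosureS F G : F `<=` G -> wclosure nK F `<=` wclosure nK G.
Proof.
move=> FG s [ds hs]; split=> // S e e0; have [t Ft tS] := hs S e e0.
by exists t => //; exact: FG.
Qed.

Lemma wclosure_idem F : wclosed nK (wclosure nK F).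
Proof.
move=> s [ds hs]; split=> // S e e0; have e20 : 0 < e / 2 by rewrite divr_gt0.
have [t [_ ht] tS] := hs S _ e20; have [u Fu uS] := ht S _ e20.
exists u => // A AS; rewrite -(subrK (t A) (s A)) -addrA [e]splitr.
by apply: (le_lt_trans (nKD H _ _)); rewrite ltrD ?tS ?uS.
Qed.

Lemma wclosure_polar U F : nbhs (0 : X) U -> F `<=` polar nK U ->
  wclosure nK F `<=` polar nK U.
Proof.
move=> U0 FU s [ds hs]; split=> // A UA; apply/ler_addgt0Pl => e e0.
have [t Ft tS] := hs [:: A] e e0.
have := (FU _ Ft).2 _ UA; have := tS A (mem_head _ _).
by have := nKD H (s A - t A) (t A); rewrite subrK; lra.
Qed.

(** The faces where [A], then [B 0], [B 1] and so on are maximal form a decreasing chain of nonempty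
    compact sets. A common point is extreme: the ends of a segment around it lie in every face,
    hence agree at each [B i]. *)
Lemma extreme_face (F : set (X -> K)) (B : nat -> X) A :
  compact (F : set {ptws X -> K}) -> F !=set0 ->
  (forall s t, F s -> F t -> (forall i, re (s (B i)) = re (t (B i))) -> s = t) ->
  exists2 s, extreme emb F s & forall t, F t -> re (t A) <= re (s A).
Proof.
move=> cF F0 sepB.
pose face C (G : set {ptws X -> K}) :=
  [set s | G s /\ forall t, G t -> re (t C) <= re (s C)].
have face_prop C (G : set {ptws X -> K}) : compact G -> G !=set0 ->
    compact (face C G) /\ face C G !=set0.
  move=> cG G0.
  have [|s] := @compact_EVT_max _ _ (fun s : {ptws X -> K} => re (s C)) G G0 cG.
    by apply: continuous_subspaceT; exact: re_eval_continuous.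
  rewrite inE => Gs smax; split; last first.
    by exists s; split => // t Gt; apply: smax; rewrite inE.
  rewrite (_ : face C G = G `&` [set t | re (s C) <= re (t C)]).
    apply: compact_closedI => //.
    by apply: (preimage_closed _ (@closed_ge _ (re (s C)))) => x _;
      exact: re_eval_continuous.
  apply/seteqP; split=> t [Gt ht]; split=> //; first exact: ht.
  by move=> u Gu; apply: le_trans ht; apply: smax; rewrite inE.
pose Fs := fix Fs n : set {ptws X -> K} :=
  if n is n'.+1 then face (B n') (Fs n') else face A F.
have FsP n : compact (Fs n) /\ Fs n !=set0.
  by elim: n => [|n [h1 h2]]; exact: face_prop.
have Fs_decr m n : (m <= n)%N -> Fs n `<=` Fs m.
  elim: n => [|n IH]; first by rewrite leqn0 => /eqP ->.
  rewrite leq_eqVlt => /orP [/eqP -> //|mn] s [Fns _]; exact: IH.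
have FsF n : Fs n `<=` F by move=> s /(Fs_decr 0%N n (leq0n n)) [].
have Fs_face n (s t1 t2 : X -> K) (r : R) : 0 < r < 1 -> F t1 -> F t2 -> Fs n s ->
    s = (fun C => emb r * t1 C + (1 - emb r) * t2 C) -> Fs n t1 /\ Fs n t2.
  move=> /andP[r0 r1] Ft1 Ft2.
  have step C (G : set {ptws X -> K}) : face C G s -> G t1 -> G t2 ->
      s = (fun C => emb r * t1 C + (1 - emb r) * t2 C) -> face C G t1 /\ face C G t2.
    move=> [Gs smax] G1 G2 sE.
    have : re (s C) = r * re (t1 C) + (1 - r) * re (t2 C).
      by rewrite sE (reD H) -(rmorph1 emb) -rmorphB !(reZ H).
    have := smax _ G1; have := smax _ G2 => h2 h1 hE.
    have e1 : re (t1 C) = re (s C) by nra.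
    have e2 : re (t2 C) = re (s C) by nra.
    by split; split=> // u Gu; rewrite ?e1 ?e2; exact: smax.
  elim: n => [|n IH] /= hs sE; first exact: (step A).
  have [G1 G2] := IH (hs.1) sE.
  exact: (step (B n)).
(* A cluster point of a sequence with [u n] in [Fs n] belongs to every face, since these are closed
   and decreasing. *)
have [s Fss] : exists s : {ptws X -> K}, forall n, Fs n s.
  have [u uP] : exists u : nat -> {ptws X -> K}, forall n, Fs n (u n).
    by exists (fun n => sval (cid (FsP n).2)) => n; case: cid.
  have uF0 : (u @ \oo) (Fs 0%N).
    by exists 0%N => // n _; exact: (Fs_decr 0%N n (leq0n n)).
  have [s [_ clus]] := (FsP 0%N).1 _ _ uF0.
  exists s => n; have clFs : closed (Fs n).
    apply: compact_closed; last exact: (FsP n).1.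
    by apply: (@hausdorff_product X (fun=> K)) => _; exact: norm_hausdorff.
  apply: clFs => V Vs; apply: clus => //.
  by exists n => // m /= nm; exact: (Fs_decr n m nm).
exists s; last exact: (Fss 0%N).2.
split=> [|t1 t2 r F1 F2 r01 sE]; first exact: FsF (Fss 0%N).
apply: sepB => // i.
have [[G1 m1] [G2 m2]] := Fs_face i.+1 s t1 t2 r r01 F1 F2 (Fss _) sE.
by apply/eqP; rewrite eq_le m1 ?m2.
Qed.

End Compactness.

(** The cap at 1 handles the empty list and later ensures [1 - eps >= 0]. *)
Lemma seq_lower_bound (R : realType) (T : eqType) (L : seq T) (d : T -> R) :
  (forall i, i \in L -> 0 < d i) ->
  exists2 e : R, 0 < e <= 1 & forall i, i \in L -> e <= d i.
Proof.
elim: L => [|i L IH] dL; first by exists 1; rewrite ?ltr01 ?lexx.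
have [|e /andP[e0 e1] eL] := IH.
  by move=> j jL; apply: dL; rewrite inE jL orbT.
have d0 := dL i (mem_head _ _).
exists (Num.min e (d i)).
  by rewrite lt_min e0 d0 ge_min e1.
move=> j; rewrite inE => /orP [/eqP ->|jL]; first by rewrite ge_min lexx orbT.
by rewrite ge_min eL.
Qed.

Lemma continuous_ptws (T : topologicalType) (I : eqType) (Y : topologicalType)
    (f : T -> {ptws I -> Y}) :
  (forall i, continuous (fun p => f p i)) -> continuous f.
Proof.
move=> cf p; apply/cvg_sup => i V [W [[C oC CW] Wp WV]].
apply: (@filterS _ (nbhs p) (nbhs_filter p) _ _ _ (cf i p C _)).
  by move=> q Cq; apply: WV; rewrite -CW.
by apply: open_nbhs_nbhs; split=> //; move: Wp; rewrite -CW.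
Qed.

(** * Separation by finitely many coordinates, and slices at extreme points *)

Section Separation.
Variables (R : realType) (K : numFieldType) (emb : {rmorphism R -> K}).
Variables (nK re : K -> R) (jj kk : K) (H : real_part emb nK re jj kk).
Variable X : topologicalLmodType K.
Implicit Types (A B : X) (F G : set (X -> K)) (s t : X -> K).

Lemma re_comb (r : R) x y : re (emb r * x + (1 - emb r) * y) = r * re x + (1 - r) * re y.
Proof. by rewrite (reD H) -(rmorph1 emb) -rmorphB !(reZ H). Qed.

Lemma re_klin_sum s (S : seq X) (a : X -> R) : klinear s ->
  re (s (\sum_(A <- S) emb (a A) *: A)) = \sum_(A <- S) a A * re (s A).
Proof.
move=> ls; rewrite (klin_sum ls) (re_sum H); apply: eq_bigr => A _.
by rewrite (klinZ ls) (reZ H).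
Qed.

Lemma klinear_re_inj s t : klinear s -> klinear t ->
  (forall A, re (s A) = re (t A)) -> s = t.
Proof.
move=> ls lt st; apply/funext => A.
by rewrite (re_dec H (s A)) (re_dec H (t A)) -(klinZ ls) -(klinZ lt) !st.
Qed.

(* The separating functional points from the nearest point of F, for the
   Euclidean distance of the coordinates in S, towards f. *)
Lemma separation F (f : X -> R) (S : seq X) :
  compact (F : set {ptws X -> K}) -> F !=set0 -> convex_fset emb F ->
  (forall t, F t -> exists2 A, A \in S & f A != re (t A)) ->
  exists (a : X -> R) (d : R), 0 < d /\ forall t, F t ->
    \sum_(A <- S) a A * re (t A) + d <= \sum_(A <- S) a A * f A.
Proof.
move=> cF F0 cvF Ff; pose Q (t : {ptws X -> K}) := \sum_(A <- S) (f A - re (t A)) ^+ 2.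
have [|t0] := @compact_EVT_min _ _ Q F F0 cF.
  apply: continuous_subspaceT; apply: continuous_sum => A t.
  apply: (@continuous_comp _ _ _ (fun t : {ptws X -> K} => re (t A))
    (fun x : R => (f A - x) ^+ 2)); first exact: (re_eval_continuous H).
  apply: (@continuous_comp _ _ _ (fun x : R => f A - x) (fun x : R => x ^+ 2)).
    by apply: cvgB; [exact: cvg_cst|exact: cvg_id].
  exact: (@exprn_continuous R 2).
rewrite inE => Ft0 t0min.
pose a A := f A - re (t0 A).
have Q0 : 0 < Q t0.
  have [A AS fA] := Ff _ Ft0; rewrite lt_def sumr_ge0 ?andbT; last first.
    by move=> *; exact: sqr_ge0.
  apply: contra fA => Q0; move: Q0; rewrite psumr_eq0; last by move=> *; exact: sqr_ge0.
  by move=> /allP /(_ _ AS); rewrite implyTb sqrf_eq0 subr_eq0.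
exists a, (Q t0); split=> // t Ft.
pose u A := re (t A) - re (t0 A).
pose au := \sum_(A <- S) a A * u A; pose uu := \sum_(A <- S) u A ^+ 2.
have uu0 : 0 <= uu by apply: sumr_ge0 => *; exact: sqr_ge0.
(* Minimality of [t0] compared with the point of weight [r] on the segment from [t0] to [t]. *)
have qr r : 0 <= r <= 1 -> 0 <= r ^+ 2 * uu - 2 * r * au.
  move=> r01; have := t0min _ (mem_set (cvF t t0 Ft Ft0 r r01)).
  rewrite -subr_ge0 -sumrB; congr (0 <= _).
  rewrite !mulr_sumr -sumrB; apply: eq_bigr => A _.
  by rewrite re_comb /u /a; ring.
have au0 : au <= 0.
  rewrite leNgt; apply/negP => au0.
  (* If [au > 0], this [r] satisfies [r * uu < 2 * au], against [qr]. *)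
  pose r := Num.min 1 (au / (uu + 1)).
  have r0 : 0 < r by rewrite lt_min ltr01 divr_gt0//; lra.
  have r1 : r <= 1 by rewrite ge_min lexx.
  have rau : r * (uu + 1) <= au.
    by rewrite -ler_pdivlMr ?ge_min ?lexx ?orbT//; lra.
  have := qr r; rewrite (ltW r0) r1 => /(_ isT).
  have -> : r ^+ 2 * uu - 2 * r * au = r * (r * uu - 2 * au) by ring.
  by rewrite pmulr_rge0//; nra.
have -> : \sum_(A <- S) a A * f A = \sum_(A <- S) a A * re (t A) + (Q t0 - au).
  rewrite /Q /au -sumrB -big_split /=; apply: eq_bigr => A _.
  by rewrite /a /u; ring.
by lra.
Qed.

(** Within a compact box, the complement of [W] is covered by finitely many half-spaces that miss
    [F] by a margin. Each one tests a functional only at a single vector [vec i], so closeness at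
    finitely many vectors keeps [s] out of all of them. *)
Lemma finite_coordinate_stability F (S0 : seq X) (W : set (X -> R)) (g : X -> R) :
  compact (F : set {ptws X -> K}) -> F !=set0 -> convex_fset emb F ->
  (forall t, F t -> klinear t) -> (forall t A, F t -> nK (t A) <= g A) ->
  @open {ptws X -> R} W ->
  (forall f f', (forall A, A \in S0 -> f A = f' A) -> W f -> W f') ->
  (forall t, F t -> W (re \o t)) ->
  exists (S : seq X) (e : R), 0 < e /\ forall s, klinear s ->
    (forall A, A \in S -> exists2 t, F t & nK (t A - s A) < e) -> W (re \o s).
Proof.
move=> cF F0 cvF lF gF oW locW FW.
(* [W] ignores the coordinates outside [S0], which are frozen at 0; the slack 1 absorbs the error
   [e <= 1] at the others. *)
pose box A : set R := if A \in S0 then `[- (g A + 1), g A + 1]%classic else [set 0].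
pose P : set {ptws X -> R} := [set f | forall A, box A (f A)].
have cP : compact P.
  apply: (@tychonoff X (fun=> R) box) => A; rewrite /box.
  by case: ifP => _; [exact: segment_compact|exact: compact_set1].
have cC : compact (P `&` ~` W) by apply: compact_closedI => //; exact: open_closedC.
(* An index holds the coefficients of a half-space, its threshold, and the margin by which [F] stays
   below the threshold. *)
pose I := ((X -> R) * (R * R))%type.
pose good (i : I) := 0 < i.2.2 /\
  forall t, F t -> \sum_(A <- S0) i.1 A * re (t A) + i.2.2 <= i.2.1.
pose V (i : I) : set {ptws X -> R} := [set f | i.2.1 < \sum_(A <- S0) i.1 A * f A].
have [i _|f [Pf Wf]|L [Lgood CL]] :=
    @compact_finite_cover {ptws X -> R} I (P `&` ~` W) good V cC.
- rewrite (_ : V i = (fun f : {ptws X -> R} => \sum_(A <- S0) i.1 A * f A) @^-1`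
    [set x | i.2.1 < x]) //.
  apply: open_comp; last exact: open_gt.
  move=> f _; apply: continuous_sum => A {}f.
  apply: (@continuous_comp _ _ _ (fun f : {ptws X -> R} => f A) (fun x : R => i.1 A * x)).
    exact: (@proj_continuous X (fun=> R) A).
  exact: mulrl_continuous.
- have [t Ft|a [d [d0 ad]]] := @separation F f S0 cF F0 cvF.
    apply: contrapT => nA; apply: Wf; apply: (locW (re \o t)); last exact: FW.
    move=> A AS; apply/eqP/negPn/negP => fA; apply: nA; exists A => //.
    by rewrite eq_sym.
  exists (a, (\sum_(A <- S0) a A * f A - d / 2, d / 2)).
    split=> /=; first by rewrite divr_gt0.
    by move=> t /ad; lra.
  by rewrite /V /=; lra.
have [e /andP[e0 e1] eL] := @seq_lower_bound R I L (fun i => i.2.2)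
  (fun i iL => (Lgood i iL).1).
pose vec (i : I) := \sum_(A <- S0) emb (i.1 A) *: A.
exists (S0 ++ [seq vec i | i <- L]), e; split=> // s ls Fs.
pose f A := if A \in S0 then re (s A) else 0.
apply: (locW f) => [A AS|]; first by rewrite /f AS.
apply: contrapT => Wf; have [|i iL] := CL f.
  split=> // A; rewrite /box /f; case: ifPn => // AS.
  have [|t Ft tA] := Fs A; first by rewrite mem_cat AS.
  have := le_trans (re_le_nK H _) (gF t A Ft).
  have := le_lt_trans (re_le_nK H _) tA; rewrite (reB H).
  rewrite /= in_itv /= ltr_norml !ler_norml => /andP[? ?] /andP[? ?].
  by apply/andP; split; lra.
have -> : V i f = (i.2.1 < re (s (vec i))) :> Prop.
  rewrite /V /= re_klin_sum //; congr (is_true (_ < _)).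
  by apply: eq_big_seq => A AS; rewrite /f AS.
have [|t Ft tA] := Fs (vec i); first by rewrite mem_cat map_f ?orbT.
have [_ /(_ t Ft)] := Lgood i iL.
rewrite -re_klin_sum; last exact: lF.
have := le_lt_trans (re_le_nK H _) tA; rewrite (reB H) ltr_norml => /andP[? ?].
rewrite -/(vec i); have := eL i iL; lra.
Qed.

(** The convex join of [G1] and [G2] is the continuous image of a compact parameter set. An extreme
    point of [F] lying in it would coincide with an end of its segment, hence lie in [G1] or
    [G2]. *)
Lemma join_avoiding F G1 G2 s : extreme emb F s -> convex_fset emb F ->
  (forall G, (G = G1 \/ G = G2) -> [/\ G `<=` F, compact (G : set {ptws X -> K}),
     convex_fset emb G & ~ G s]) ->
  exists G, [/\ G `<=` F, compact (G : set {ptws X -> K}), convex_fset emb G, ~ G s &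
     G1 `|` G2 `<=` G].
Proof.
move=> [Fs exs] cvF h.
have [F1 c1 v1 s1] := h G1 (or_introl erefl).
have [F2 c2 v2 s2] := h G2 (or_intror erefl).
have [[u1 Gu1]|G10] := pselect (G1 !=set0); last first.
  by exists G2; split=> // t [Gt|//]; case: G10; exists t.
have [[u2 Gu2]|G20] := pselect (G2 !=set0); last first.
  by exists G1; split=> // t [//|Gt]; case: G20; exists t.
pose m (p : R * ({ptws X -> K} * {ptws X -> K})) : {ptws X -> K} :=
  fun A => emb p.1 * p.2.1 A + (1 - emb p.1) * p.2.2 A.
pose J : set {ptws X -> K} := m @` (`[0, 1]%classic `*` (G1 `*` G2)).
(* Two weighted points of a convex set merge into one carrying the total weight; this makes the join
   convex. If both weights are 0, any point will do. *)
have mix (G : set (X -> K)) a b x y : convex_fset emb G -> 0 <= a -> 0 <= b -> G x -> G y ->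
    exists2 z, G z & forall A, emb a * x A + emb b * y A = emb (a + b) * z A.
  move=> cvG a0 b0 Gx Gy; have [ab|ab] := eqVneq (a + b) 0.
    exists x => // A; have [-> ->] : a = 0 /\ b = 0 by lra.
    by rewrite addr0 rmorph0 !mul0r addr0.
  have ab0 : 0 < a + b by rewrite lt_def ab addr_ge0.
  exists (fun A => emb (a / (a + b)) * x A + (1 - emb (a / (a + b))) * y A).
    by apply: cvG => //; rewrite (divr_ge0 a0 (ltW ab0)) /= ler_pdivrMr// mul1r lerDl.
  move=> A; rewrite mulrDr !mulrA -(rmorph1 emb) -rmorphB -!rmorphM.
  by congr (emb _ * _ + emb _ * _); field.
exists J; split.
- move=> _ [[r [t1 t2]] [/= r01 [G1t G2t]] <-]; apply: cvF; [exact: F1|exact: F2|].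
  by move: r01; rewrite in_itv.
- apply: (@continuous_compact _ {ptws X -> K} m).
    apply/continuous_subspaceT/continuous_ptws => A p.
    apply: (@continuous_comp (R * ({ptws X -> K} * {ptws X -> K}))%type
      (R * (K * K))%type K (fun p => (p.1, (p.2.1 A, p.2.2 A)))
      (fun p => emb p.1 * p.2.1 + (1 - emb p.1) * p.2.2)); last exact: (comb_continuous H).
    apply: (@cvg_pair _ _ _ _ (nbhs p.1) (nbhs (p.2.1 A, p.2.2 A))).
      exact: cvg_fst.
    apply: (@cvg_pair _ _ _ _ (nbhs (p.2.1 A)) (nbhs (p.2.2 A))).
      apply: (@continuous_comp _ _ _ (fun x : R * ({ptws X -> K} * {ptws X -> K}) => x.2.1)
        (fun t : {ptws X -> K} => t A)); last exact: eval_continuous.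
      by apply: continuous_comp; [exact: cvg_snd|exact: cvg_fst].
    apply: (@continuous_comp _ _ _ (fun x : R * ({ptws X -> K} * {ptws X -> K}) => x.2.2)
      (fun t : {ptws X -> K} => t A)); last exact: eval_continuous.
    by apply: continuous_comp; [exact: cvg_snd|exact: cvg_snd].
  by apply: compact_setX; [exact: segment_compact|exact: compact_setX].
- move=> _ _ [[q [x y]] [/= + [Gx Gy]] <-] [[q' [x' y']] [/= + [Gx' Gy']] <-] r /andP[r0 r1].
  rewrite !in_itv /= => /andP[q0 q1] /andP[q'0 q'1].
  have [||z Gz hz] := mix G1 (r * q) ((1 - r) * q') x x' v1 _ _ Gx Gx'.
  + by rewrite mulr_ge0.
  + by rewrite mulr_ge0 ?subr_ge0.
  have [||w Gw hw] := mix G2 (r * (1 - q)) ((1 - r) * (1 - q')) y y' v2 _ _ Gy Gy'.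
  + by rewrite mulr_ge0 ?subr_ge0.
  + by rewrite mulr_ge0 ?subr_ge0.
  exists (r * q + (1 - r) * q', (z, w)).
    split=> //=; rewrite in_itv /=; apply/andP; split; nra.
  apply/funext => A; rewrite /m /= -hz.
  have -> : 1 - emb (r * q + (1 - r) * q') = emb (r * (1 - q) + (1 - r) * (1 - q')).
    by rewrite -(rmorph1 emb) -rmorphB; congr (emb _); ring.
  by rewrite -hw !(rmorphD, rmorphM, rmorphB, rmorph1) /=; ring.
- move=> [[r [x y]] [/= + [Gx Gy]] ms]; rewrite in_itv /= => /andP[r0 r1].
  have [r0E|rn0] := eqVneq r 0.
    apply: s2; rewrite -ms; suff -> : m (r, (x, y)) = y by [].
    by apply/funext => A; rewrite /m /= r0E rmorph0 mul0r add0r subr0 mul1r.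
  have [r1E|rn1] := eqVneq r 1.
    apply: s1; rewrite -ms; suff -> : m (r, (x, y)) = x by [].
    by apply/funext => A; rewrite /m /= r1E rmorph1 mul1r subrr mul0r addr0.
  have xy : x = y.
    apply: (exs x y r (F1 _ Gx) (F2 _ Gy)); last by rewrite -ms.
    by rewrite !lt_def rn0 r0 eq_sym rn1 r1.
  apply: s1; rewrite -ms; suff -> : m (r, (x, y)) = x by [].
  by apply/funext => A; rewrite /m /= -xy; ring.
- move=> t [Gt|Gt].
    exists (1, (t, u2)); first by split=> //=; rewrite in_itv /= ler01 lexx.
    by apply/funext => A; rewrite /m /= rmorph1 mul1r subrr mul0r addr0.
  exists (0, (u1, t)); first by split=> //=; rewrite in_itv /= ler01 lexx.
  by apply/funext => A; rewrite /m /= rmorph0 mul0r add0r subr0 mul1r.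
Qed.

(** Choquet's lemma: outside the neighbourhood of [s], [F] is a finite union of pieces cut by
    half-spaces. By [join_avoiding], a compact convex subset of [F] contains them all and misses
    [s]; separating [s] from it gives the slice. *)
Lemma extreme_slice F s (B : nat -> X) (n : nat) (e : R) :
  compact (F : set {ptws X -> K}) -> convex_fset emb F ->
  (forall t, F t -> klinear t) -> extreme emb F s -> 0 < e ->
  exists A c, c < re (s A) /\ forall t, F t -> c <= re (t A) ->
    forall i, (i <= n)%N -> `|re (s (B i) - t (B i))| < e.
Proof.
move=> cF cvF lF exs e0; have Fs := exs.1.
have pieces (L : seq (X * R)) : (forall p, p \in L -> re (s p.1) < p.2) ->
    exists G, [/\ G `<=` F, compact (G : set {ptws X -> K}), convex_fset emb G, ~ G s &
      forall t, F t -> (exists2 p, p \in L & p.2 <= re (t p.1)) -> G t].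
  elim: L => [|[C b] L IH] hL.
    by exists set0; split=> // [|t _ []//]; exact: compact0.
  have [|G [GF cG vG nG GL]] := IH; first by move=> p pL; apply: hL; rewrite inE pL orbT.
  pose G' := F `&` [set t | b <= re (t C)].
  have [G0|J [JF cJ vJ nJ GJ]] := @join_avoiding F G G' s exs cvF.
    case=> ->; split=> //.
    - by move=> t [].
    - apply: (@compact_closedI {ptws X -> K}) => //.
      by apply: (preimage_closed _ (@closed_ge _ b)) => x _; exact: (re_eval_continuous H).
    - move=> t u [Ft /= ht] [Fu /= hu] r r01; split; first exact: cvF.
      by move: r01 => /= /andP[r0 r1]; rewrite re_comb; nra.
    - move=> [_ /=]; have := hL (C, b) (mem_head _ _); rewrite /=; lra.
  exists J; split=> // t Ft [p]; rewrite inE => /orP [/eqP ->|pL] ht.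
    by apply: GJ; right.
  by apply: GJ; left; apply: GL => //; exists p.
pose L := [seq (B i, re (s (B i)) + e) | i <- iota 0 n.+1] ++
          [seq (- B i, - re (s (B i)) + e) | i <- iota 0 n.+1].
have [p|G [GF cG vG nG GL]] := pieces L.
  rewrite mem_cat => /orP [] /mapP [i _ ->] /=; first lra.
  by rewrite (klinN (lF _ Fs)) (reN H); lra.
have near_s t : F t -> ~ G t -> forall i, (i <= n)%N -> `|re (s (B i) - t (B i))| < e.
  move=> Ft nGt i iln; rewrite ltNge; apply/negP => hti; apply: nGt; apply: GL => //.
  have iI : i \in iota 0 n.+1 by rewrite mem_iota.
  move: hti; rewrite (reB H) ler_normr => /orP [] hti.
    exists (- B i, - re (s (B i)) + e); first by rewrite mem_cat (map_f _ iI) orbT.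
    by rewrite /= (klinN (lF _ Ft)) (reN H); lra.
  exists (B i, re (s (B i)) + e); first by rewrite mem_cat (map_f _ iI).
  by rewrite /=; lra.
have [G0|G0] := pselect (G !=set0); last first.
  (* With nothing to avoid, the slice is all of [F]. *)
  exists 0, (re (s 0) - 1); split; first lra.
  by move=> t Ft _; apply: near_s => // Gt; apply: G0; exists t.
(* By compactness, finitely many coordinates distinguish [s] from all points of [G], as [separation]
   requires. *)
have [A _|t Gt|S [_ GS]] := @compact_finite_cover {ptws X -> K} X G setT
  (fun A => [set t | re (t A) != re (s A)]) cG.
- rewrite (_ : [set t | _] = (fun t : {ptws X -> K} => re (t A)) @^-1`
    [set x | x != re (s A)]) //.
  apply: open_comp; last exact: open_neq.
  by move=> t _; exact: (re_eval_continuous H).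
- apply: contrapT => nA; apply: nG; rewrite -(_ : t = s) //.
  apply: klinear_re_inj; [exact: lF (GF _ Gt)|exact: lF|].
  move=> A; apply/eqP/negPn/negP => tA; apply: nA; by exists A.
have [t Gt|a [d [d0 ad]]] := @separation G (re \o s) S cG G0 vG.
  by have [A AS tA] := GS t Gt; exists A => //; rewrite eq_sym.
exists (\sum_(A <- S) emb (a A) *: A), (re (s (\sum_(A <- S) emb (a A) *: A)) - d / 2).
split; first lra.
move=> t Ft; rewrite !re_klin_sum; [|exact: lF..] => ht; apply: near_s => // Gt.
by have /= := ad t Gt; lra.
Qed.

End Separation.

Lemma open_all_seq (T : topologicalType) (I : eqType) (L : seq I) (V : I -> set T) :
  (forall i, i \in L -> open (V i)) -> open [set x | forall i, i \in L -> V i x].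
Proof.
elim: L => [|i L IH] oV.
  by rewrite (_ : [set x | _] = setT); [exact: openT|apply/seteqP; split].
rewrite (_ : [set x | _] = V i `&` [set x | forall j, j \in L -> V j x]).
  by apply: openI; [exact/oV/mem_head|apply: IH => j jL; apply: oV; rewrite inE jL orbT].
apply/seteqP; split=> x /=.
  by move=> h; split=> [|j jL]; apply: h; rewrite inE ?eqxx ?jL ?orbT.
by move=> [Vi h] j; rewrite inE => /orP [/eqP ->|/h].
Qed.

Lemma evalR_continuous (R : realType) (I : eqType) (i : I) :
  continuous (fun f : {ptws I -> R} => f i).
Proof. exact: (@proj_continuous I (fun=> R) i). Qed.

(** * Hausdorff pseudodistances and the small-slice condition *)

Section Hausdorff.
Variables (R : realType) (K : numFieldType) (emb : {rmorphism R -> K}).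
Variables (nK re : K -> R) (jj kk : K) (H : real_part emb nK re jj kk).
Variable X : topologicalLmodType K.
Implicit Types (A : X) (F G : set (X -> K)) (s t : X -> K) (S : seq X).

Lemma hdist_ltP A F G (e : R) : (hdist nK A F G < e%:E)%E ->
  (forall s, F s -> exists2 t, G t & nK (s A - t A) < e) /\
  (forall t, G t -> exists2 s, F s & nK (s A - t A) < e).
Proof.
rewrite /hdist gt_max => /andP[h1 h2]; split=> [s Fs|t Gt].
  have /(le_lt_trans)/(_ h1)/ereal_inf_lt : (ereal_inf [set (nK (s A - t A))%:E | t in G] <=
      ereal_sup [set ereal_inf [set (nK (s A - t A))%:E | t in G] | s in F])%E.
    by apply: ereal_sup_ubound; exists s.
  by move=> [_ [t Gt <-]]; rewrite lte_fin => ?; exists t.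
have /(le_lt_trans)/(_ h2)/ereal_inf_lt : (ereal_inf [set (nK (s A - t A))%:E | s in F] <=
    ereal_sup [set ereal_inf [set (nK (s A - t A))%:E | s in F] | t in G])%E.
  by apply: ereal_sup_ubound; exists t.
by move=> [_ [s Fs <-]]; rewrite lte_fin => ?; exists s.
Qed.

Lemma hdist_le A F G (e : R) :
  (forall s, F s -> exists2 t, G t & nK (s A - t A) <= e) ->
  (forall t, G t -> exists2 s, F s & nK (s A - t A) <= e) ->
  (hdist nK A F G <= e%:E)%E.
Proof.
move=> h1 h2; rewrite /hdist ge_max; apply/andP; split.
  apply: ge_ereal_sup => _ [s Fs <-]; have [t Gt st] := h1 s Fs.
  by apply: (@le_trans _ _ (nK (s A - t A))%:E); [apply: ereal_inf_lbound; exists t|].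
apply: ge_ereal_sup => _ [t Gt <-]; have [s Fs st] := h2 t Gt.
by apply: (@le_trans _ _ (nK (s A - t A))%:E); [apply: ereal_inf_lbound; exists s|].
Qed.

Variable B : nat -> X.

(** One index governs both the coordinates and the tolerance. For dense [B], these relations give
    neighbourhood bases on a polar, by [polar_dense_approx]. *)
Definition near_upto (n : nat) (f f' : X -> R) :=
  forall i, (i <= n)%N -> `|f (B i) - f' (B i)| < n.+1%:R^-1.

(* F is covered by finitely many small neighbourhoods, each of which contains
   the part of F cut off by a half-space whose interior meets F. *)
Definition small_slices (n : nat) F := exists L : seq ((X -> K) * X * R),
  [/\ forall l, l \in L -> exists2 t, F t & l.2 < re (t l.1.2),
      forall t, F t -> exists2 l, l \in L & near_upto n (re \o l.1.1) (re \o t)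
    & forall l, l \in L -> forall t, F t -> l.2 <= re (t l.1.2) ->
        near_upto n (re \o l.1.1) (re \o t)].

Lemma near_upto_open n (f : X -> R) : @open {ptws X -> R} (near_upto n f).
Proof.
rewrite (_ : near_upto n f = [set f' | forall i, i \in iota 0 n.+1 ->
    [set f' : {ptws X -> R} | `|f (B i) - f' (B i)| < n.+1%:R^-1] f']).
  apply: open_all_seq => i _.
  rewrite [X in open X](_ : _ = (fun f' : {ptws X -> R} => f' (B i)) @^-1`
    ball (f (B i)) (n.+1%:R^-1 : R)) //.
  apply: (@open_comp {ptws X -> R} R); first by move=> f' _; exact: evalR_continuous.
  by apply: ball_open; rewrite invr_gt0 ltr0n.
apply/seteqP; split=> f' h i; first by rewrite mem_iota => /h.
by move=> iln; apply: (h i); rewrite mem_iota.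
Qed.

(** The same list serves for [G]. Covering and smallness confine functionals to an open set [W] of
    finitely many coordinates, which [finite_coordinate_stability] handles; each slice still meets
    [G] because [F] exceeds its threshold by a positive gap. *)
Lemma small_slices_stable U F n : nbhs (0 : X) U -> CU_U emb nK U F ->
  small_slices n F -> exists S (e : R), 0 < e /\ forall G,
    (forall s, G s -> klinear s) ->
    (forall A, A \in S -> (hdist nK A F G < e%:E)%E) -> small_slices n G.
Proof.
move=> U0 FCU [L [L1 L2 L3]]; have [F0 [cvF [wF FU]]] := FCU.
have lF t : F t -> klinear t by move=> /FU /polar_klinear.
(* Slices are closed, so their smallness is an open condition: a functional is strictly below the
   threshold or near the centre. *)
pose W : set {ptws X -> R} :=
  (\bigcup_(l in [set l | l \in L]) near_upto n (re \o l.1.1)) `&`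
  [set f | forall l, l \in L ->
    ([set f : {ptws X -> R} | f l.1.2 < l.2] `|` near_upto n (re \o l.1.1)) f].
have oW : @open {ptws X -> R} W.
  apply: openI; first by apply: bigcup_open => l _; exact: near_upto_open.
  apply: open_all_seq => l _; apply: openU; last exact: near_upto_open.
  rewrite [X in open X](_ : _ = (fun f : {ptws X -> R} => f l.1.2) @^-1`
    [set x | x < l.2]) //.
  apply: (@open_comp {ptws X -> R} R); last exact: open_lt.
  by move=> f _; exact: evalR_continuous.
pose S0 := [seq B i | i <- iota 0 n.+1] ++ [seq l.1.2 | l <- L].
have near_loc f f' g : (forall A, A \in S0 -> f A = f' A) -> near_upto n g f -> near_upto n g f'.
  move=> ff' gf i iln; rewrite -ff'; first exact: gf.
  by rewrite mem_cat map_f// mem_iota.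
have locW f f' : (forall A, A \in S0 -> f A = f' A) -> W f -> W f'.
  move=> ff' [[l lL lf] Wf]; split; first by exists l => //; exact: near_loc lf.
  move=> k kL; case: (Wf k kL) => h; [left|right; exact: near_loc h].
  by rewrite /= -ff'// mem_cat (map_f (fun l => l.1.2)) ?orbT.
have FW t : F t -> W (re \o t).
  move=> Ft; split; first by have [l lL lt] := L2 t Ft; exists l.
  move=> l lL; have [lt|lt] := ltP (re (t l.1.2)) l.2; [by left|right].
  exact: L3.
have [g [_ gU]] := gaugeP H U0.
have [S [e [e0 Se]]] := finite_coordinate_stability H (compact_CU_U H U0 FCU) F0 cvF lF
  (fun t A Ft => gU t A (FU t Ft)) oW locW FW.
pose gap (l : (X -> K) * X * R) : R :=
  if pselect (exists2 t, F t & l.2 < re (t l.1.2)) is left h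
  then re ((s2val (cid2 h)) l.1.2) - l.2 else 1.
have gapP l : l \in L -> 0 < gap l /\ exists2 t, F t & gap l = re (t l.1.2) - l.2.
  move=> lL; rewrite /gap; case: pselect => [h|/(_ (L1 l lL))//].
  by case: cid2 => t Ft lt /=; rewrite subr_gt0; split=> //; exists t.
have [e' /andP[e'0 _] e'L] := seq_lower_bound (fun l lL => (gapP l lL).1).
exists (S ++ [seq l.1.2 | l <- L]), (Num.min e e'); split; first by rewrite lt_min e0 e'0.
move=> G lG dG; have GW s : G s -> W (re \o s).
  move=> Gs; apply: Se; first exact: lG.
  move=> A AS; have [|_ /(_ s Gs) [t Ft ts]] := hdist_ltP (dG A _).
    by rewrite mem_cat AS.
  by exists t => //; apply: (lt_le_trans ts); rewrite ge_min lexx.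
exists L; split.
- move=> l lL; have [_ [t Ft gapE]] := gapP l lL.
  have [|/(_ t Ft) [s Gs ts] _] := hdist_ltP (dG l.1.2 _).
    by rewrite mem_cat (map_f (fun l => l.1.2)) ?orbT.
  exists s => //; have := le_lt_trans (re_le_nK H _) ts.
  rewrite lt_min (reB H) !ltr_norml => /andP[_ /andP[_ h]].
  by have := e'L l lL; rewrite gapE; lra.
- by move=> t /GW [[l lL lt] _]; exists l.
- by move=> l lL t /GW [_ /(_ l lL) [/=|//]]; lra.
Qed.

(** Each slice contains an extreme point, a maximizer over [F] of the vector defining the slice.
    Conversely, compactness selects finitely many extreme points as centres, and Choquet's lemma
    gives a slice around each. *)
Lemma small_slicesP U F : nbhs (0 : X) U -> closure (range B) = setT -> CU_U emb nK U F ->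
  (forall n, small_slices n F) <-> F = wclosure nK (extreme emb F).
Proof.
move=> U0 dB FCU; have [F0 [cvF [wF FU]]] := FCU.
have cF := compact_CU_U H U0 FCU.
have lF t : F t -> klinear t by move=> /FU /polar_klinear.
have sepB s t : F s -> F t -> (forall i, re (s (B i)) = re (t (B i))) -> s = t.
  by move=> Fs Ft; apply: (polar_dense_inj H U0 dB); exact: FU.
split=> [hn|Fext n].
  apply/seteqP; split; last first.
    move=> s hs; apply: wF; apply: wclosureS hs; by move=> t [].
  move=> s Fs; split; first by case: (FU s Fs).
  move=> S e e0; have [n nP] := polar_dense_approx H S U0 dB e0.
  (* The tolerance [1 / (2n + 2)] is half the one at [n]: [s] and the extreme point are both
     compared with the centre. *)
  have [L [L1 L2 L3]] := hn n.*2.+1; have [l lL ls] := L2 s Fs.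
  have [t Ft lt] := L1 l lL.
  have [x xext xmax] := @extreme_face R K emb nK re jj kk H X F B l.1.2 cF F0 sepB.
  have lx : l.2 <= re (x l.1.2) by apply: (le_trans (ltW lt)); exact: xmax.
  exists x => // A AS; apply: nP AS; [exact: FU|exact: FU xext.1|].
  move=> i iln; have iln2 : (i <= n.*2.+1)%N by lia.
  have := ls i iln2; have := L3 l lL x xext.1 lx i iln2.
  have -> : n.*2.+2%:R^-1 = n.+1%:R^-1 / 2 :> R.
    by rewrite -doubleS -muln2 natrM invfM.
  rewrite /= (reB H); move: (n.+1%:R^-1 : R) => d; rewrite !ltr_norml.
  by move=> /andP[? ?] /andP[? ?]; apply/andP; split; lra.
pose V s : set {ptws X -> K} := [set t : X -> K | near_upto n (re \o s) (re \o t)].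
have [s _|t Ft|L [Lext FL]] := @compact_finite_cover {ptws X -> K} (X -> K) F (extreme emb F) V cF.
- rewrite [X in open X](_ : _ = (fun t : {ptws X -> K} => (re \o t : {ptws X -> R})) @^-1`
    near_upto n (re \o s)) //.
  apply: (@open_comp {ptws X -> K} {ptws X -> R}); last exact: near_upto_open.
  by move=> t _; apply: continuous_ptws => A; exact: (re_eval_continuous H).
- move: Ft; rewrite {1}Fext => -[dt /(_ [seq B i | i <- iota 0 n.+1] n.+1%:R^-1)].
  rewrite invr_gt0 ltr0n => /(_ isT) [s exs st]; exists s => // i iln.
  rewrite /= -(reB H); apply: (le_lt_trans (re_le_nK H _)); rewrite (nK_distC H).
  by apply: st; rewrite map_f// mem_iota.
have sl s : extreme emb F s -> exists Ac : X * R, Ac.2 < re (s Ac.1) /\ forall t, F t ->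
    Ac.2 <= re (t Ac.1) -> near_upto n (re \o s) (re \o t).
  move=> exs; have [|A [c [sc hc]]] := extreme_slice H B n (e := n.+1%:R^-1) cF cvF lF exs.
    by rewrite invr_gt0 ltr0n.
  by exists (A, c); split=> // t Ft tc i iln; rewrite /= -(reB H); exact: hc.
pose sel s : X * R := if pselect (extreme emb F s) is left h then sval (cid (sl s h)) else (0, 0).
have selP s : extreme emb F s -> (sel s).2 < re (s (sel s).1) /\ forall t, F t ->
    (sel s).2 <= re (t (sel s).1) -> near_upto n (re \o s) (re \o t).
  by move=> h; rewrite /sel; case: pselect => // h'; case: cid.
exists [seq (s, (sel s).1, (sel s).2) | s <- L]; split.
- by move=> _ /mapP [s /Lext exs ->] /=; exists s; [exact: exs.1|exact: (selP s exs).1].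
- by move=> t /FL [s sL st]; exists (s, (sel s).1, (sel s).2) => //; exact: map_f.
- by move=> _ /mapP [s /Lext exs ->] /=; exact: (selP s exs).2.
Qed.

End Hausdorff.

(** Since [P n] looks only at earlier terms, the history can be kept as a finite list padded with
    [y0]. *)
Lemma history_choice (Y : Type) (y0 : Y) (P : nat -> (nat -> Y) -> Y -> Prop) :
  (forall n h h' y, (forall i, (i < n)%N -> h i = h' i) -> P n h y -> P n h' y) ->
  (forall n h, (forall i, (i < n)%N -> P i h (h i)) -> exists y, P n h y) ->
  exists h, forall n, P n h (h n).
Proof.
move=> Ploc Pex.
pose f n h := if pselect (exists y, P n h y) is left e then sval (cid e) else y0.
have fP n h : (exists y, P n h y) -> P n h (f n h).
  by move=> e; rewrite /f; case: pselect => // e'; case: cid.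
pose g := fix g n := if n is n'.+1 then rcons (g n') (f n' (nth y0 (g n'))) else [::].
have sg n : size (g n) = n by elim: n => //= n IH; rewrite size_rcons IH.
pose h n := f n (nth y0 (g n)).
have gh n i : (i < n)%N -> nth y0 (g n) i = h i.
  elim: n => // n IH; rewrite ltnS leq_eqVlt nth_rcons sg => /orP [/eqP ->|ilt].
    by rewrite ltnn eqxx.
  by rewrite ilt IH.
exists h; elim/ltn_ind => n IH.
apply: (Ploc n (nth y0 (g n))); first exact: gh.
apply: fP; apply: Pex => i iltn; rewrite gh //.
by apply: (Ploc i h) (IH i iltn) => j jlt; rewrite gh // (ltn_trans jlt).
Qed.

Lemma half_exp_lt (R : realType) (e : R) : 0 < e ->
  exists N, forall n, (N <= n)%N -> 2^-1 ^+ n < e.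
Proof.
move=> e0; have [N hN] := inv_succ_lt e0; exists N => n Nn.
apply: (le_lt_trans _ hN); rewrite exprVn lef_pV2 ?posrE ?ltr0n ?exprn_gt0//.
by rewrite -natrX ler_nat (leq_trans _ (ltn_expl n (ltnSn 1))).
Qed.

(** * Escaping finitely many functionals by independence *)

Section LinearAlgebra.
Variables (K : numFieldType) (X : topologicalLmodType K).
Implicit Types (s phi : X -> K).

(** The triangular relations make the [A i] span a complement of the joint kernel of the [v i]; each
    induction step subtracts [v k x *: A k]. *)
Lemma klinear_eq0_of_triangular (k : nat) (v : nat -> X -> K) (A : nat -> X) phi :
  (forall i, (i < k)%N -> klinear (v i)) -> klinear phi ->
  (forall i, (i < k)%N -> v i (A i) = 1) ->
  (forall i j, (i < j < k)%N -> v i (A j) = 0) ->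
  (forall x, (forall i, (i < k)%N -> v i x = 0) -> phi x = 0) ->
  (forall i, (i < k)%N -> phi (A i) = 0) -> forall x, phi x = 0.
Proof.
move=> + lphi; elim: k => [|k IH] lv v1 v0 phiZ phiA; first by move=> x; exact: phiZ.
apply: IH.
- by move=> i ik; apply: lv; rewrite (ltn_trans ik).
- by move=> i ik; apply: v1; rewrite (ltn_trans ik).
- by move=> i j /andP[ij jk]; apply: v0; rewrite ij (ltn_trans jk).
- move=> x xZ; have -> : x = v k x *: A k + (x - v k x *: A k) by rewrite addrC subrK.
  rewrite lphi phiA // mulr0 add0r; apply: phiZ => i; rewrite ltnS leq_eqVlt.
  case/orP => [/eqP ->|ik].
    by rewrite (klinB (lv _ (ltnSn k))) (klinZ (lv _ (ltnSn k))) v1 // mulr1 subrr.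
  have li := lv i (ltn_trans ik (ltnSn k)).
  by rewrite (klinB li) (klinZ li) v0 ?ik ?ltnSn// mulr0 xZ// subrr.
- by move=> i ik; apply: phiA; rewrite (ltn_trans ik).
Qed.

(** Otherwise all [tau n] coincide on the joint kernel of the [v i], so the differences
    [tau i.+1 - tau 0] are determined by their values at [k] vectors. Then [k + 1] of them are
    dependent, against the independence of [tau]. *)
Lemma independent_escape (k : nat) (v : nat -> X -> K) (A : nat -> X)
    (tau : nat -> X -> K) (b : X -> K) (d : K) :
  (forall i, (i < k)%N -> klinear (v i)) ->
  (forall i, (i < k)%N -> v i (A i) = 1) ->
  (forall i j, (i < j < k)%N -> v i (A j) = 0) ->
  (forall n, klinear (tau n)) ->
  (forall (N : nat) (c : nat -> K), (forall x, \sum_(i < N) c i * tau i x = 0) ->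
     forall i, (i < N)%N -> c i = 0) ->
  d != 0 ->
  exists n x, (forall i, (i < k)%N -> v i x = 0) /\ b x + d * tau n x != 0.
Proof.
move=> lv v1 v0 lt indep d0; apply: contrapT => nex.
have tauZ n x : (forall i, (i < k)%N -> v i x = 0) -> tau n x = tau 0%N x.
  move=> xZ; have z j : b x + d * tau j x = 0.
    by apply/eqP/negPn/negP => h; apply: nex; exists j, x.
  have := z 0%N; rewrite -(z n) => /addrI /(mulfI d0) ->; by [].
pose M : 'M[K]_(k.+1, k) := \matrix_(i, j) (tau i.+1 (A j) - tau 0%N (A j)).
have : kermx M != 0.
  rewrite -mxrank_eq0 mxrank_ker -lt0n subn_gt0.
  by apply: leq_ltn_trans (rank_leq_col M) _.
move=> /rowV0Pn [c /sub_kermxP cM c0].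
have [i0 ci0] : exists i, c 0 i != 0.
  apply: contrapT => nc; move/negP: c0; apply; apply/eqP/rowP => i; rewrite mxE.
  by apply/eqP/negPn/negP => ci; apply: nc; exists i.
pose phi x := \sum_(i < k.+1) c 0 i * (tau i.+1 x - tau 0%N x).
have phi0 x : phi x = 0.
  apply: (klinear_eq0_of_triangular lv _ v1 v0) => {x}.
  - move=> a x y; rewrite /phi mulr_sumr -big_split; apply: eq_bigr => i _ /=.
    by rewrite !lt; ring.
  - by move=> x xZ; apply: big1 => i _; rewrite tauZ // subrr mulr0.
  - move=> i ik; have /rowP /(_ (Ordinal ik)) := cM; rewrite !mxE => h.
    by rewrite -[RHS]h; apply: eq_bigr => j _; rewrite mxE.
pose c' (i : nat) := if i is i'.+1 then (if insub i' is Some o then c 0 o else 0)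
  else - \sum_(i < k.+1) c 0 i.
have c'0 : c' i0.+1 = 0.
  apply: (indep k.+2); last by rewrite ltnS.
  move=> x; rewrite big_ord_recl /= -[RHS](phi0 x) /phi.
  rewrite mulNr mulr_suml -sumrN -big_split; apply: eq_bigr => i _ /=.
  by rewrite /bump /= add1n valK; ring.
by move: ci0; rewrite -c'0 /c' valK eqxx.
Qed.

End LinearAlgebra.

(** * Convexity from midpoints *)

Section Midpoints.
Variables (R : realType) (K : numFieldType) (emb : {rmorphism R -> K}).
Variables (nK re : K -> R) (jj kk : K) (H : real_part emb nK re jj kk).
Variable X : topologicalLmodType K.

Lemma nK_half (x y : K) :
  nK (emb 2^-1 * x + (1 - emb 2^-1) * y) <= (nK x + nK y) / 2.
Proof.
have -> : 1 - emb 2^-1 = emb 2^-1.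
  by rewrite -(rmorph1 emb) -rmorphB; congr (emb _); field.
apply: (le_trans (nKD H _ _)); rewrite !(nKM H) (nK_emb H) ?invr_ge0//; lra.
Qed.

Lemma polar_comb (U : set X) (s t : X -> K) (r : R) : nbhs (0 : X) U -> 0 <= r <= 1 ->
  polar nK U s -> polar nK U t -> polar nK U (fun A => emb r * s A + (1 - emb r) * t A).
Proof.
move=> U0 /andP[r0 r1] sU tU; apply: (klinear_polar H U0) => [|A UA].
  by apply: klinear_comb; [exact: polar_klinear sU|exact: polar_klinear tU].
apply: (le_trans (nKD H _ _)).
rewrite !(nKM H) -(rmorph1 emb) -rmorphB !(nK_emb H) ?subr_ge0//.
by have := sU.2 A UA; have := tU.2 A UA; nra.
Qed.

Lemma wclosed_midpoint_convex (U : set X) (F : set (X -> K)) : nbhs (0 : X) U ->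
  F `<=` polar nK U -> wclosed nK F ->
  (forall s t, F s -> F t -> F (fun A => emb 2^-1 * s A + (1 - emb 2^-1) * t A)) ->
  convex_fset emb F.
Proof.
move=> U0 FU wF mF s t Fs Ft r r01.
pose c r A := emb r * s A + (1 - emb r) * t A.
have dyadic n : forall r, 0 <= r <= 1 -> exists2 r', F (c r') & `|r - r'| <= 2^-1 ^+ n.
  elim: n => [|n IH] {r01}r /andP[r0 r1].
    exists 1; last by rewrite expr0 ler_norml; apply/andP; split; lra.
    by rewrite (_ : c 1 = s) //; apply/funext => A; rewrite /c rmorph1 subrr; ring.
  (* The approximant for [2 * r] is averaged with [t], or the one for [2 * r - 1] with [s]; either
     way the error is halved. *)
  have [r2|r2] := leP r 2^-1.
    have [|r' Fr' rr'] := IH (2 * r); first by apply/andP; split; lra.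
    exists (2^-1 * r').
      have := mF _ _ Fr' Ft; congr F; apply/funext => A.
      by rewrite /c rmorphM; ring.
    rewrite exprS; move: rr'; rewrite !ler_norml => /andP[? ?]; apply/andP; split; lra.
  have [|r' Fr' rr'] := IH (2 * r - 1); first by apply/andP; split; lra.
  exists (2^-1 + (1 - 2^-1) * r').
    have := mF _ _ Fs Fr'; congr F; apply/funext => A.
    by rewrite /c rmorphD rmorphM rmorphB rmorph1; ring.
  rewrite exprS; move: rr'; rewrite !ler_norml => /andP[? ?]; apply/andP; split; lra.
apply: wF; split; first by case: (polar_comb U0 r01 (FU _ Fs) (FU _ Ft)).
move=> S e e0.
have [M M0 MS] : exists2 M : R, 0 < M & forall A, A \in S -> nK (s A - t A) <= M.
  have [g g0 gS] := @seq_lower_bound R X S (fun A => (nK (s A - t A) + 1)^-1)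
    (fun A _ => ltac:(rewrite invr_gt0; have := nK_ge0 H (s A - t A); lra)).
  have /andP[gp _] := g0.
  exists g^-1 => [|A AS]; first by rewrite invr_gt0.
  have p := nK_ge0 H (s A - t A).
  have := gS A AS; rewrite -[X in X <= _ -> _]invrK lef_pV2 ?posrE ?invr_gt0//; lra.
have [n /(_ n (leqnn n)) nM] := half_exp_lt (divr_gt0 e0 M0).
have [r' Fr' rr'] := dyadic n r r01.
exists (c r') => // A AS.
have -> : c r A - c r' A = emb (r - r') * (s A - t A) by rewrite /c rmorphB; ring.
rewrite (nKM H) (nK_emb_norm H); move: nM; rewrite ltr_pdivlMr// => /le_lt_trans; apply.
by apply: ler_pM => //; [exact: (nK_ge0 H)|exact: MS].
Qed.

End Midpoints.

(** The factor [5 ^ N] makes the number large without changing the two valuations. *)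
Lemma logn_pair (k l N : nat) : exists n, [/\ (N <= n)%N, logn 2 n = k & logn 3 n = l].
Proof.
exists (2 ^ k * 3 ^ l * 5 ^ N)%N; split.
- rewrite (leq_trans (ltnW (ltn_expl N (isT : 1 < 5)%N)))// leq_pmull//.
  by rewrite muln_gt0 !expn_gt0.
- by rewrite !lognM ?muln_gt0 ?expn_gt0// !lognX /= muln1 !muln0 !addn0.
- by rewrite !lognM ?muln_gt0 ?expn_gt0// !lognX /= muln1 !muln0 !addn0.
Qed.

(** * Approximation by Poulsen-type sets *)

Section Density.
Variables (R : realType) (K : numFieldType) (emb : {rmorphism R -> K}).
Variables (nK re : K -> R) (jj kk : K) (H : real_part emb nK re jj kk).
Variable X : topologicalLmodType K.
Implicit Types (U : set X) (F G : set (X -> K)) (s t : X -> K).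

(** Dividing each functional by a positive bound for it on [U] preserves independence. *)
Lemma infdim_polar U : nbhs (0 : X) U -> infdim_cond nK U ->
  exists tau : nat -> X -> K, (forall n, polar nK U (tau n)) /\
    forall (N : nat) (c : nat -> K), (forall x, \sum_(i < N) c i * tau i x = 0) ->
      forall i, (i < N)%N -> c i = 0.
Proof.
move=> U0 [sg [dsg [indep bsg]]].
pose M n := `|sval (cid (bsg n))| + 1.
have MP n : 0 < M n /\ forall A, U A -> nK (sg n A) <= M n.
  rewrite /M; case: cid => b /= bP; split=> [|A UA]; first by rewrite ltr_wpDl.
  by have := bP A UA; have := ler_norm b; lra.
have eM n : emb (M n)^-1 != 0.
  rewrite -(rmorph0 emb); apply/eqP => /(emb_inj H)/eqP.
  by rewrite invr_eq0; case: (MP n) => + _; rewrite lt_def => /andP[/negbTE ->].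
exists (fun n x => emb (M n)^-1 * sg n x); split=> [n|N c cs i iN].
  have [M0 Mb] := MP n; have [lsg _] := dsg n.
  apply: (klinear_polar H U0) => [a x y|A UA]; first by rewrite lsg; ring.
  rewrite (nKM H) (nK_emb H) ?invr_ge0 ?(ltW M0)//.
  by rewrite mulrC ler_pdivrMr// mul1r Mb.
have /eqP : c i * emb (M i)^-1 = 0.
  apply: (indep N (fun i => c i * emb (M i)^-1)) => // A; rewrite -[RHS](cs A).
  by apply: eq_bigr => j _; rewrite mulrA.
by rewrite mulf_eq0 (negbTE (eM i)) orbF => /eqP.
Qed.

Section Construction.
Variables (m : nat) (p tau : nat -> X -> K) (eps : R) (g : X -> R).

(* For n >= m the next point is a perturbed midpoint of two earlier ones, and
   n |-> (logn 2 n, logn 3 n) takes every pair of indices infinitely often. *)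
Definition base (v : nat -> X -> K) (n : nat) (x : X) : K :=
  if (n < m)%N then emb (1 - eps) * p n x
  else emb 2^-1 * v (logn 2 n) x + (1 - emb 2^-1) * v (logn 3 n) x.

(** The bound with [eps] serves to keep the sequence in the polar; the one with [g (A l)] limits how
    far later terms exceed the value 1 that [v l] will take at [A l]. *)
Definition perturbed (v : nat -> X -> K) (A : nat -> X) (n : nat) (w : X -> K) :=
  exists (d : R) (k : nat),
    [/\ 0 <= d, d <= eps * 2^-1 ^+ n.+1,
        forall l, (l < n)%N -> d * (1 + g (A l)) <= 2^-1 ^+ (l + n) &
        forall x, w x = base v n x + emb d * tau k x].

Hypotheses (m0 : (0 < m)%N) (eps0 : 0 < eps) (g0 : forall x, 0 <= g x).
Hypotheses (lp : forall n, klinear (p n)) (ltau : forall n, klinear (tau n)).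
Hypothesis indep : forall (N : nat) (c : nat -> K),
  (forall x, \sum_(i < N) c i * tau i x = 0) -> forall i, (i < N)%N -> c i = 0.

Lemma logn_lt q n : (m <= n)%N -> (logn q n < n)%N.
Proof. by move=> mn; rewrite ltn_logl // (leq_trans m0). Qed.

(** Terms and vectors are chosen together. Once the size of the perturbation is fixed,
    [independent_escape] gives a direction and a vector killed by the earlier terms but not by the
    new one; rescaling it gives [A n]. *)
Lemma poulsen_sequence : exists (v : nat -> X -> K) (A : nat -> X),
  [/\ forall n, klinear (v n), forall n, v n (A n) = 1,
      forall i n, (i < n)%N -> v i (A n) = 0 &
      forall n, perturbed v A n (v n)].
Proof.
pose P n (h : nat -> (X -> K) * X) (y : (X -> K) * X) :=
  [/\ klinear y.1, y.1 y.2 = 1, forall i, (i < n)%N -> (h i).1 y.2 = 0 &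
      perturbed (fun i => (h i).1) (fun i => (h i).2) n y.1].
have base_loc n v v' : (forall i, (i < n)%N -> v i = v' i) -> base v n =1 base v' n.
  move=> vv' x; rewrite /base; case: ltnP => // mn.
  by rewrite !vv' ?logn_lt.
have [n h h' y hh' [ly y1 y0 [d [k [d0 dn dl yE]]]]|n h IH|f fP] :=
    @history_choice _ ((fun=> 0), 0) P.
- split=> // [i iln|]; first by rewrite -hh' // y0.
  exists d, k; split=> // [l ln|x]; first by rewrite -hh' // dl.
  by rewrite yE (base_loc _ _ (fun i => (h' i).1))// => i iln; rewrite hh'.
- have g1 x : 0 < 1 + g x by rewrite ltr_wpDr.
  have [l _|d /andP[d0 _] dl] := @seq_lower_bound R nat (iota 0 n)
    (fun l => 2^-1 ^+ (l + n) / (1 + g (h l).2)).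
    by rewrite divr_gt0 ?exprn_gt0 ?invr_gt0.
  pose d' := Num.min d (eps * 2^-1 ^+ n.+1).
  have d'0 : 0 < d' by rewrite lt_min d0 mulr_gt0// exprn_gt0 ?invr_gt0.
  have [||||k [x [x0 bx]]] := @independent_escape K X n (fun i => (h i).1)
      (fun i => (h i).2) tau (base (fun i => (h i).1) n) (emb d') _ _ _ ltau indep.
  + by move=> i /IH [].
  + by move=> i /IH [].
  + by move=> i j /andP[ij /IH [_ _ + _]]; apply.
  + by rewrite -(rmorph0 emb) (inj_eq (emb_inj H)) gt_eqF.
  set w := fun x => base (fun i => (h i).1) n x + emb d' * tau k x.
  have lh i : (i < n)%N -> klinear (h i).1 by move=> /IH [].
  have lw : klinear w.
    move=> a y z; rewrite /w ltau /base; case: ltnP => mn.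
      by rewrite lp; ring.
    by rewrite !lh ?logn_lt//; ring.
  exists (w, (w x)^-1 *: x); split=> //=.
  + by rewrite (klinZ lw) mulVf.
  + by move=> i iln; rewrite (klinZ (lh i iln)) x0 // mulr0.
  + exists d', k; split=> //; first exact: ltW.
      by rewrite ge_min lexx orbT.
    move=> l ln; rewrite -ler_pdivlMr //.
    by rewrite (le_trans _ (dl l _)) ?mem_iota// ge_min lexx.
exists (fun n => (f n).1), (fun n => (f n).2); split=> [n|n|i n|n]; case: (fP n) => //.
by move=> _ _ h _; exact: h.
Qed.

End Construction.

Lemma D_U_dense U F (B : nat -> X) (S0 : seq X) (e : R) :
  nbhs (0 : X) U -> closure (range B) = setT -> infdim_cond nK U ->
  CU_U emb nK U F -> 0 < e ->
  exists G, D_U emb nK U G /\ forall A, A \in S0 -> (hdist nK A F G < e%:E)%E.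
Proof.
move=> U0 dB inf FCU e0; have [[s0 Fs0] [cvF [wF FU]]] := FCU.
have [g [g0 gU]] := gaugeP H U0.
have [tau [tauU indep]] := infdim_polar U0 inf.
(* The errors [eps] from the net, [eps * g A] from shrinking and [eps * g A] from perturbing then
   add up to at most [e / 2]. *)
have [A _|eps /andP[eps0 eps1] epsS] := @seq_lower_bound R X S0
    (fun A => e / (2 * (1 + 2 * g A))).
  by rewrite divr_gt0// mulr_gt0//; have := g0 A; lra.
pose V s : set {ptws X -> K} := [set t : X -> K | forall A, A \in S0 -> nK (t A - s A) < eps].
have [s _|t Ft|L [LF FL]] := @compact_finite_cover {ptws X -> K} (X -> K) F F V
    (compact_CU_U H U0 FCU).
- apply: open_all_seq => A _.
  rewrite [X in open X](_ : _ = (fun t : {ptws X -> K} => nK (t A - s A)) @^-1`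
    [set x | x < eps]) //.
  apply: (@open_comp {ptws X -> K} R); last exact: open_lt.
  by move=> t _; exact: (nK_eval_continuous H).
- by exists t => // A _; rewrite subrr (nK0 H).
(* Beyond the net, the default [s0] keeps [p n] in [F]. *)
pose p n := nth s0 L n; pose m := size L.
have Fp n : F (p n).
  rewrite /p; have [mn|nm] := leqP m n; first by rewrite nth_default.
  exact/LF/mem_nth.
have m0 : (0 < m)%N by have [l + _] := FL _ Fs0; rewrite /m; case: (L).
have [v [A [lv v1 v0 vP]]] := poulsen_sequence m0 eps0 g0
  (fun n => polar_klinear (FU _ (Fp n))) (fun n => polar_klinear (tauU n)) indep.
pose h : R := 2^-1.
have hn0 n : 0 < h ^+ n by rewrite exprn_gt0 // invr_gt0.
have hn1 n : h ^+ n <= 1 by rewrite exprn_ile1 // ?invr_ge0// invf_le1//; lra.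
have hS n : h ^+ n.+1 = h ^+ n / 2 by rewrite exprSr.
have h_mono i n : (i <= n)%N -> h ^+ n <= h ^+ i.
  by move=> ?; rewrite ler_wiXn2l // ?invr_ge0// invf_le1//; lra.
(* Earlier errors are averaged and the new perturbation adds at most [eps * h ^+ n.+1]. The bound
   [y] is left free in order to be 1 on [U] and [g x] elsewhere. *)
have nearF n : exists2 q, F q & forall x y, (forall k, nK (tau k x) <= y) ->
    nK (v n x - emb (1 - eps) * q x) <= eps * (1 - h ^+ n.+1) * y.
  elim/ltn_ind: n => n IH; have [d [k [d0 dn _ vE]]] := vP n.
  have [nm|mn] := ltnP n m.
    exists (p n) => // x y hy; rewrite vE /base nm addrC addKr (nKM H) (nK_emb H)//.
    have y0 : 0 <= y := le_trans (nK_ge0 H _) (hy 0%N).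
    apply: ler_pM => //; first exact: (nK_ge0 H).
    apply: (le_trans dn); rewrite ler_pM2l // hS; have := hn1 n; lra.
  have [qi Fi hi] := IH _ (logn_lt m0 2 mn); have [qj Fj hj] := IH _ (logn_lt m0 3 mn).
  exists (fun x => emb h * qi x + (1 - emb h) * qj x).
    by apply: cvF => //; rewrite invr_ge0 invf_le1//; lra.
  move=> x y hy; have y0 : 0 <= y := le_trans (nK_ge0 H _) (hy 0%N).
  have bnd i z : (i < n)%N -> z <= eps * (1 - h ^+ i.+1) * y -> z <= eps * (1 - h ^+ n) * y.
    move=> iln /le_trans; apply; rewrite ler_wpM2r// ler_pM2l// lerD2l lerN2.
    exact: h_mono.
  have {}hi := bnd _ _ (logn_lt m0 2 mn) (hi x y hy).
  have {}hj := bnd _ _ (logn_lt m0 3 mn) (hj x y hy).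
  rewrite vE /base ltnNge mn /=.
  set vi := v _ x in hi *; set vj := v _ x in hj *.
  have -> : emb 2^-1 * vi + (1 - emb 2^-1) * vj + emb d * tau k x
      - emb (1 - eps) * (emb h * qi x + (1 - emb h) * qj x) =
      (emb 2^-1 * (vi - emb (1 - eps) * qi x) + (1 - emb 2^-1) * (vj - emb (1 - eps) * qj x))
      + emb d * tau k x by rewrite /h; ring.
  apply: (le_trans (nKD H _ _)); rewrite (nKM H) (nK_emb H)//.
  have dy : d * nK (tau k x) <= eps * h ^+ n.+1 * y.
    by apply: ler_pM => //; exact: (nK_ge0 H).
  have := nK_half H (vi - emb (1 - eps) * qi x) (vj - emb (1 - eps) * qj x).
  by move: dy; rewrite hS; lra.
have nKeps x : nK (emb (1 - eps) * x) = (1 - eps) * nK x.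
  by rewrite (nKM H) (nK_emb H)// subr_ge0.
have vU n : polar nK U (v n).
  apply: (klinear_polar H U0) => // x Ux; have [q Fq hq] := nearF n.
  have {}hq := hq x 1 (fun k => (tauU k).2 x Ux).
  have := nKD H (v n x - emb (1 - eps) * q x) (emb (1 - eps) * q x).
  rewrite subrK nKeps; have := (FU _ Fq).2 x Ux; have := hn0 n.+1; nra.
pose G := wclosure nK (range v).
have GU : G `<=` polar nK U by apply: (wclosure_polar H U0) => _ [n _ <-].
have Gv n : G (v n).
  split; first by case: (vU n).
  by move=> S d d0; exists (v n) => // x _; rewrite subrr (nK0 H).
have wG : wclosed nK G by exact: (wclosure_idem H).
(* Every pair of indices recurs arbitrarily late, where the perturbation is negligible. *)
have approx k l (S : seq X) (d : R) N : 0 < d -> exists n, [/\ (N <= n)%N, (m <= n)%N &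
    forall x, x \in S -> nK (v n x - (emb 2^-1 * v k x + (1 - emb 2^-1) * v l x)) < d].
  move=> d0; have [x _|d' /andP[d'0 _] d'S] := @seq_lower_bound R X S (fun x => d / (1 + g x)).
    by rewrite divr_gt0// ltr_wpDr.
  have [N' hN'] := half_exp_lt d'0.
  have [n [Nn n2 n3]] := logn_pair k l (maxn N (maxn N' m)).
  move: Nn; rewrite !geq_max => /and3P[Nn N'n mn]; exists n; split=> // x xS.
  have [c [j [c0 cn _ ->]]] := vP n; rewrite /base ltnNge mn /= n2 n3 addrC addKr.
  rewrite (nKM H) (nK_emb H)//.
  have cd : c <= d / (1 + g x).
    apply: (le_trans _ (d'S x xS)); apply: (le_trans cn); apply: (le_trans _ (ltW (hN' n N'n))).
    rewrite -/h hS; have := hn0 n; nra.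
  have gx := gU _ x (tauU j); have := g0 x; move: cd.
  rewrite ler_pdivlMr ?ltr_wpDr//; have := nK_ge0 H (tau j x); nra.
have cvG : convex_fset emb G.
  apply: (wclosed_midpoint_convex H U0 GU wG) => s t Gs Gt; split.
    suff : polar nK U (fun A => emb 2^-1 * s A + (1 - emb 2^-1) * t A) by case.
    by apply: (polar_comb H U0 _ (GU _ Gs) (GU _ Gt)); rewrite invr_ge0 invf_le1//; lra.
  move=> S d d0; have d20 : 0 < d / 2 by rewrite divr_gt0.
  have [_ [k _ <-] sk] := Gs.2 S _ d20; have [_ [l _ <-] tl] := Gt.2 S _ d20.
  have [n [_ _ hn]] := approx k l S _ 0%N d20.
  exists (v n) => // x xS.
  have := nK_half H (s x - v k x) (t x - v l x); have := hn x xS.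
  have := sk x xS; have := tl x xS.
  rewrite (nK_distC H (v n x)).
  set a := emb _ * (s x - _) + _; set b := _ - v n x.
  have -> : emb 2^-1 * s x + (1 - emb 2^-1) * t x - v n x = a + b by rewrite /a /b; ring.
  by have := nKD H a b; lra.
(* The distance to [v n] is charged to the drop of the value at [A n] below 1. For [k < n] that
   value is 0, and [2 * g x] bounds any distance; for [k > n] two earlier estimates are averaged and
   the growth of [1 - h ^+ k] absorbs the perturbation. *)
have ineq n k x : (m <= n)%N ->
    nK (v k x - v n x) + 2 * g x * re (v k (A n)) <= 2 * g x * (1 + h ^+ n * (1 - h ^+ k)).
  move=> mn; elim/ltn_ind: k => k IH; have gx0 := g0 x.
  have [kn|nk|->] := ltngtP k n.
  - rewrite (v0 _ _ kn) (re0 H) mulr0 addr0.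
    have := nKD H (v k x) (- v n x); rewrite (nKN H).
    have := gU _ x (vU k); have := gU _ x (vU n).
    have : 0 <= 2 * g x * (h ^+ n * (1 - h ^+ k)).
      by rewrite !mulr_ge0 ?subr_ge0// ltW.
    by lra.
  - have mk := leq_trans mn (ltnW nk).
    have [d [j [d0 _ dl vE]]] := vP k.
    have mono i : (i < k)%N -> nK (v i x - v n x) + 2 * g x * re (v i (A n)) <=
        2 * g x * (1 + h ^+ n * (1 - 2 * h ^+ k)).
      move=> ik; apply: (le_trans (IH i ik)).
      rewrite ler_wpM2l ?mulr_ge0// lerD2l ler_wpM2l ?(ltW (hn0 n))//.
      have : h ^+ k <= h ^+ i / 2 by rewrite -hS h_mono.
      lra.
    have hi := mono _ (logn_lt m0 2 mk); have hj := mono _ (logn_lt m0 3 mk).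
    rewrite !vE /base ltnNge mk /=.
    set vi := v (logn 2 k) in hi *; set vj := v (logn 3 k) in hj *.
    have -> : emb 2^-1 * vi x + (1 - emb 2^-1) * vj x + emb d * tau j x - v n x =
      (emb 2^-1 * (vi x - v n x) + (1 - emb 2^-1) * (vj x - v n x)) + emb d * tau j x by ring.
    have t1 := nKD H (emb 2^-1 * (vi x - v n x) + (1 - emb 2^-1) * (vj x - v n x))
      (emb d * tau j x).
    have t2 := nK_half H (vi x - v n x) (vj x - v n x).
    rewrite (nKM H (emb d)) (nK_emb H d0) in t1.
    rewrite (reD H) (re_comb H) (reZ H).
    have t3 := gU _ x (tauU j).
    have t4 : re (tau j (A n)) <= g (A n).
      exact: le_trans (ler_norm _) (le_trans (re_le_nK H _) (gU _ (A n) (tauU j))).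
    have t5 := dl n nk; rewrite exprD in t5.
    have t6 : d * nK (tau j x) <= d * g x by rewrite ler_wpM2l.
    have t7 : 2 * g x * (d * re (tau j (A n))) <= 2 * g x * (d * g (A n)).
      by rewrite ler_wpM2l ?mulr_ge0// ler_wpM2l.
    have t8 : 2 * g x * (d * (1 + g (A n))) <= 2 * g x * (h ^+ n * h ^+ k).
      by rewrite ler_wpM2l ?mulr_ge0.
    have t9 : 0 <= d * g x by rewrite mulr_ge0.
    move: t1 t2 t6 t7 t8 t9 hi hj; clear; lra.
  - have : 0 <= 2 * g x * (h ^+ n * (1 - h ^+ n)).
      by rewrite !mulr_ge0 ?subr_ge0// ltW.
    rewrite subrr (nK0 H) v1 (re1 H); lra.
have ineqG s n x : G s -> (m <= n)%N ->
    nK (s x - v n x) + 2 * g x * re (s (A n)) <= 2 * g x * (1 + h ^+ n).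
  move=> Gs mn; apply/ler_addgt0Pl => d d0; have gx0 := g0 x.
  have d'0 : 0 < d / (1 + 2 * g x) by rewrite divr_gt0//; lra.
  have [_ [k _ <-] sk] := Gs.2 [:: x; A n] _ d'0.
  have a1 := sk x (mem_head _ _).
  have a2 : nK (s (A n) - v k (A n)) < d / (1 + 2 * g x) by apply: sk; rewrite !inE eqxx orbT.
  have a3 := le_lt_trans (ler_norm _) (le_lt_trans (re_le_nK H _) a2).
  rewrite (reB H) in a3.
  have a4 := nKD H (s x - v k x) (v k x - v n x); rewrite subrKA in a4.
  have a5 := ineq n k x mn.
  have a6 : 2 * g x * (h ^+ n * h ^+ k) >= 0.
    by rewrite !mulr_ge0// ltW.
  have dE : d = d / (1 + 2 * g x) + 2 * g x * (d / (1 + 2 * g x)).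
    by rewrite -[X in X + _]mul1r -mulrDl mulrC divfK// gt_eqF//; lra.
  have a7 : 2 * g x * (re (s (A n)) - re (v k (A n))) <= 2 * g x * (d / (1 + 2 * g x)).
    by rewrite ler_wpM2l ?mulr_ge0// ltW.
  rewrite [X in _ <= X + _]dE; move: a1 a4 a5 a6 a7; lra.
have GCU : CU_U emb nK U G by split; [exists (v 0%N)|split].
have sepG s t : G s -> G t -> (forall i, re (s (B i)) = re (t (B i))) -> s = t.
  by move=> Gs Gt; apply: (polar_dense_inj H U0 dB); exact: GU.
(* At a maximizer, the value at [A n] has real part at least 1, its value at [v n], so [ineqG]
   leaves only [2 * g x * h ^+ n] for the distance. *)
have ext n : (m <= n)%N -> exists2 s, extreme emb G s &
    forall x, nK (s x - v n x) <= 2 * g x * h ^+ n.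
  move=> mn.
  have [s exs smax] := extreme_face H (A n) (compact_CU_U H U0 GCU) GCU.1 sepG.
  exists s => // x; have := ineqG s n x exs.1 mn.
  have := smax _ (Gv n); rewrite v1 (re1 H); have := g0 x; nra.
exists G; split.
  split=> //; apply/seteqP; split; last first.
    by move=> s hs; apply: wG; apply: wclosureS hs => t [].
  move=> s Gs; split; first by case: (GU _ Gs).
  move=> S d d0; have d30 : 0 < d / 3 by rewrite divr_gt0.
  have [_ [k _ <-] sk] := Gs.2 S _ d30.
  have [x _|d' /andP[d'0 _] d'S] := @seq_lower_bound R X S (fun x => d / 3 / (1 + 2 * g x)).
    by rewrite divr_gt0//; have := g0 x; lra.
  have [N hN] := half_exp_lt d'0.
  (* The pair [(k, k)] has midpoint [v k], so [v k] nearly recurs at a late index, whose face is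
     small. *)
  have [n [Nn mn hn]] := approx k k S _ N d30.
  have [t ext_t tn] := ext n mn; exists t => // x xS.
  have b1 := sk x xS; have b2 := hn x xS; have b3 := tn x.
  have b4 : h ^+ n < d / 3 / (1 + 2 * g x) by apply: lt_le_trans (hN n Nn) (d'S x xS).
  have gx0 := g0 x.
  rewrite ltr_pdivlMr in b4; last lra.
  have vk : emb 2^-1 * v k x + (1 - emb 2^-1) * v k x = v k x by ring.
  rewrite vk (nK_distC H) in b2; rewrite (nK_distC H) in b3.
  have b5 := nKD H (s x - v k x) (v k x - t x); rewrite subrKA in b5.
  have b6 := nKD H (v k x - v n x) (v n x - t x); rewrite subrKA in b6.
  by have := hn0 n; lra.
move=> x xS; have gx0 := g0 x.
have epsx : eps * (1 + 2 * g x) <= e / 2.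
  have := epsS x xS; rewrite ler_pdivlMr; lra.
have d2 q : F q -> nK (q x - emb (1 - eps) * q x) <= eps * g x.
  move=> Fq; have -> : q x - emb (1 - eps) * q x = emb eps * q x.
    by rewrite rmorphB rmorph1; ring.
  rewrite (nKM H) (nK_emb H (ltW eps0)) ler_pM2l//; exact: gU (FU _ Fq).
apply: (@le_lt_trans _ _ (e / 2)%:E); last by rewrite lte_fin; lra.
apply: hdist_le => [s Fs|s Gs].
  have [l lL sl] := FL s Fs.
  have lm : (index l L < m)%N by rewrite index_mem.
  exists (v (index l L)) => //.
  have [d [k [d0 dn _ vE]]] := vP (index l L).
  rewrite vE /base lm /p nth_index//.
  have -> : s x - (emb (1 - eps) * l x + emb d * tau k x) =
    (s x - l x) + ((l x - emb (1 - eps) * l x) - emb d * tau k x) by ring.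
  have c1 := nKD H (s x - l x) ((l x - emb (1 - eps) * l x) - emb d * tau k x).
  have c2 := nKD H (l x - emb (1 - eps) * l x) (- (emb d * tau k x)).
  rewrite (nKN H) (nKM H) (nK_emb H d0) in c2.
  have c3 := sl x xS; have c4 := d2 l (LF l lL); have c5 := gU _ x (tauU k).
  have c6 : d <= eps.
    by apply: (le_trans dn); have := hn1 (index l L).+1; rewrite -/h; nra.
  have c7 : d * nK (tau k x) <= eps * g x by apply: ler_pM => //; exact: (nK_ge0 H).
  lra.
have [_ [n _ <-] sn] := Gs.2 [:: x] _ eps0.
have {}sn := sn x (mem_head _ _); have [q Fq hq] := nearF n.
exists q => //; have {}hq := hq x (g x) (fun k => gU _ x (tauU k)).
have c4 := d2 q Fq.
have -> : q x - s x = (q x - emb (1 - eps) * q x) +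
  ((emb (1 - eps) * q x - v n x) + (v n x - s x)) by ring.
have c1 := nKD H (q x - emb (1 - eps) * q x) ((emb (1 - eps) * q x - v n x) + (v n x - s x)).
have c2 := nKD H (emb (1 - eps) * q x - v n x) (v n x - s x).
rewrite (nK_distC H (v n x) (s x)) in c2.
rewrite (nK_distC H (emb (1 - eps) * q x) (v n x)) in c2.
have c3 : eps * (1 - h ^+ n.+1) * g x <= eps * g x.
  by rewrite ler_wpM2r// ger_pMr//; have := hn0 n.+1; lra.
lra.
Qed.

End Density.

Lemma separable_dense_sequence (T : topologicalType) (x0 : T) : separable_space T ->
  exists B : nat -> T, closure (range B) = setT.
Proof.
move=> [S [/countable_injP [f finj] dS]].
pose B n := xget x0 [set x | S x /\ f x = n].
exists B; rewrite -subTset -dS; apply: closure_subset => x Sx.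
exists (f x) => //; rewrite /B; case: xgetP => [y _ [Sy fxy]|/(_ x)]; last by case.
by apply: finj; rewrite ?inE.
Qed.

(** * The dense [G_delta] property *)

Section Genericity.
Variables (R : realType) (K : numFieldType) (emb : {rmorphism R -> K}).
Variables (nK re : K -> R) (jj kk : K) (H : real_part emb nK re jj kk).
Variables (X : topologicalLmodType K) (B : nat -> X).
Hypothesis dB : closure (range B) = setT.

(** The small-slice conditions are the open sets. Leaving [C] general covers both a fixed [U] and
    the union over all [U]. *)
Lemma hGdelta_extreme_dense (C D : set (set (X -> K))) :
  C `<=` CU emb nK -> D = [set F | C F /\ F = wclosure nK (extreme emb F)] ->
  hGdelta nK C D.
Proof.
move=> CCU ->; exists (fun n => [set F | C F /\ small_slices re B n F]).
split=> [n|].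
  split=> [F []//|F [/[dup] CF /CCU [U [U0 FU]] sF]].
  have [S [e [e0 Se]]] := small_slices_stable H U0 FU sF.
  exists S, e; split=> // G [CG dG]; split=> //; apply: Se => // s Gs.
  have [V [V0 [_ [_ [_ GV]]]]] := CCU _ CG.
  by apply: (@polar_klinear _ _ nK _ V); exact: GV.
apply/seteqP; split=> F.
  move=> [/[dup] CF /CCU [U [U0 FU]]] /(small_slicesP H U0 dB FU) sF n _.
  by split; last exact: sF.
move=> sF; have [/[dup] CF /CCU [U [U0 FU]] _] := sF 0%N I.
by split=> //; apply/(small_slicesP H U0 dB FU) => n; case: (sF n I).
Qed.

Lemma CU_U_subset (U V : set X) : V `<=` U -> CU_U emb nK U `<=` CU_U emb nK V.
Proof.
move=> VU F [F0 [cvF [wF FU]]]; split=> //; split=> //; split=> // s /FU [ds sU].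
by split=> // A /VU /sU.
Qed.

Lemma infdim_cond_subset (U V : set X) : V `<=` U -> infdim_cond nK U -> infdim_cond nK V.
Proof.
move=> VU [sg [dsg [indep bsg]]]; exists sg; split=> //; split=> // n.
by have [M hM] := bsg n; exists M => A /VU /hM.
Qed.

Lemma D_U_generic (U : set X) : nbhs (0 : X) U -> infdim_cond nK U ->
  hGdelta nK (CU_U emb nK U) (D_U emb nK U) /\ hdense nK (CU_U emb nK U) (D_U emb nK U).
Proof.
move=> U0 infU; split; first by apply: hGdelta_extreme_dense => // F FU; exists U.
split=> [F []//|O [OC Oopen] [F OF]].
have [S [e [e0 Se]]] := Oopen F OF.
have [G [DG dG]] := D_U_dense H S U0 dB infU (OC _ OF) e0.
by exists G; split=> //; apply: Se; split=> //; case: DG.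
Qed.

Lemma D_all_generic : (exists U : set X, nbhs (0 : X) U /\ infdim_cond nK U) ->
  hGdelta nK (CU (X := X) emb nK) (D_all emb nK) /\
  hdense nK (CU (X := X) emb nK) (D_all emb nK).
Proof.
move=> [V [V0 infV]]; split.
  apply: hGdelta_extreme_dense => //; apply/seteqP; split=> F.
    by move=> [U [U0 [FU Fext]]]; split=> //; exists U.
  by move=> [[U [U0 FU]] Fext]; exists U.
split=> [F [U [U0 [FU _]]]|O [OC Oopen] [F OF]]; first by exists U.
have [S [e [e0 Se]]] := Oopen F OF; have [U [U0 FU]] := OC _ OF.
(* Lying in the polar of [U] and the infinite-dimensionality of [V] both pass to smaller
   neighbourhoods. *)
have UV0 : nbhs (0 : X) (U `&` V) by exact: filterI.
have [G [DG dG]] := D_U_dense H S UV0 dB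
  (infdim_cond_subset (@subIsetr _ U V) infV) (CU_U_subset (@subIsetl _ U V) FU) e0.
exists G; split; last by exists (U `&` V).
by apply: Se; split=> //; exists (U `&` V); split=> //; case: DG.
Qed.

End Genericity.

Lemma Thm412_of_real_part (R : realType) (K : numFieldType) (emb : {rmorphism R -> K})
    (nK re : K -> R) (jj kk : K) : real_part emb nK re jj kk -> Thm412 emb nK.
Proof.
move=> H X _ _; split=> [U sepX _ U0 infU|sepX _ infX].
  by have [B dB] := separable_dense_sequence 0 sepX; exact: (D_U_generic H dB U0 infU).
by have [B dB] := separable_dense_sequence 0 sepX; exact: (D_all_generic H dB infX).
Qed.

(* K = R (emb = id, |.|) and K = C = R[i] (emb = x |-> x%:C, modulus normc). *)
Theorem theorem4p12 (R : realType) :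
  Thm412 (K := R) id Num.norm /\ Thm412 (K := R[i]) (real_complex R) (@ComplexField.Normc.normc R).
Proof.
split; first exact: (Thm412_of_real_part (real_part_real R)).
exact: (Thm412_of_real_part (real_part_complex R)).
Qed.
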